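(* Let $X_1,\dots,X_n$ be $n$ independent copies of a random vector $X\in\mathbb{R}^d$ with Gram matrix $G=\mathbb{E}(XX^\top)$. Assume that for some known constant $\kappa$ $$\sup\bigl\{\mathbb{E}(\langle\theta,X\rangle^4)\,:\,\theta\in\mathbb{R}^d,\ \mathbb{E}(\langle\theta,X\rangle^2)\le 1\bigr\}\le\kappa<\infty ,$$ and put $$\mu=\sqrt{\frac{2(\kappa-1)}{n}\bigl[\log(\epsilon^{-1})+0.73\,d\bigr]}+6.81\sqrt{\frac{2\kappa d}{n}}.$$ There exists an estimator $\widehat G$ of the Gram matrix $G$, deduced from the directional estimator $\widehat N_\lambda$ as explained in the context, such that for any confidence parameter $\epsilon>0$ and any sample size $n$ satisfying $$n>\Biggl[20\sqrt{\kappa d}+\Bigl(\frac52+\frac1{2(\kappa-1)}\Bigr)\sqrt{2(\kappa-1)\bigl[\log(\epsilon^{-1})+0.73\,d\bigr]}\Biggr]^2,$$ with probability at least $1-2\epsilon$, for any $\theta\in\mathbb{R}^d$, $$\left|\frac{\theta^\top\widehat G\,\theta}{\theta^\top G\,\theta}-1\right|\le\frac{2\mu}{1-4\mu}=\mathbf{O}\Biggl(\sqrt{\frac{\kappa[d+\log(\epsilon^{-1})]}{n}}\Biggr).$$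
   Context: Convention: $0/0=1$ and $z/0=+\infty$ for $z>0$. $A=\mathbf{O}(B)$ means that there is a numerical constant $c$ such that $A\le cB$. $\psi:\mathbb{R}\to\mathbb{R}$ is $\psi(x)=\log2$ for $x\ge1$, $\psi(x)=-\log(1-x+x^2/2)$ for $0\le x\le1$, $\psi(x)=-\psi(-x)$ for $x\le0$. Put $\lambda=\sqrt{\frac{2}{(\kappa-1)n}[\log(\epsilon^{-1})+0.73\,d]}$ and $\widehat N_\lambda(\theta)=\inf\bigl\{\rho>0:\sum_{i=1}^n\psi[\lambda(\rho^{-1}\langle\theta,X_i\rangle^2-1)]\le0\bigr\}$. Construction of $\widehat G$ (set up for an accuracy parameter $\delta\in(0,1/2)$, and applied with $\delta=\mu/(1-2\mu)$): let $V=\operatorname{span}\{X_1,\dots,X_n\}$, let $\mathbb{S}_d$ be the unit sphere of $\mathbb{R}^d$, let $(e_1,\dots,e_d)$ be an orthonormal basis of $\mathbb{R}^d$, let $\widehat\lambda_{\min}=\inf\{\widehat N_\lambda(\theta):\theta\in V\cap\mathbb{S}_d\}$, and choose $0<\rho\le\delta^2\widehat\lambda_{\min}/\bigl(2\sum_{i=1}^d\widehat N_\lambda(e_i)\bigr)$. Let $\Theta_\rho$ be a finite subset of $V\cap\mathbb{S}_d$ such that every point of $V\cap\mathbb{S}_d$ is at distance at most $\rho$ from $\Theta_\rho$. Then $\widehat G$ is a minimizer of $\operatorname{Tr}(H^2)$ among the symmetric matrices $H\in\mathbb{R}^{d\times d}$ with $\operatorname{Im}(H)\subset V$ and $(1-\delta)\widehat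 N_\lambda(\theta)\le\theta^\top H\theta\le(1+\delta)\widehat N_\lambda(\theta)$ for all $\theta\in\Theta_\rho$.
   Formalization: The condition δ=μ/(1−2μ)<1/2 (μ<1/4) is assumed, since the bound on n does not imply it and 2μ/(1−4μ) may be negative; the O(·) holds with a constant depending on η for δ≤η<1/2 and ε≤1, as no numerical constant works when μ→1/4; κ>1. *)

(* Defs.v *)
From HB Require Import structures.
From mathcomp Require Import all_boot all_order all_algebra.
From mathcomp Require Import all_classical all_reals all_analysis.

Set Implicit Arguments.
Unset Strict Implicit.
Unset Printing Implicit Defensive.

Import Order.TTheory GRing.Theory Num.Theory.
Import numFieldNormedType.Exports.

Local Open Scope classical_set_scope.
Local Open Scope ring_scope.

(** Quotient of extended reals with the convention 0 / 0 = 1.  The library's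
    division already gives z / 0 = +oo for z > 0 (and -oo for z < 0). *)
Definition ediv {R : realType} (x y : \bar R) : \bar R :=
  if (x == 0%E) && (y == 0%E) then 1%E else (x / y)%E.

(** Euclidean structure on R^d = 'cV[R]_d; the norm `|x| that the library puts
    on matrices is the sup norm, so it is not used here. *)
Definition dotv {R : realType} {d : nat} (u v : 'cV[R]_d) : R :=
  (u^T *m v) 0 0.

Definition enorm {R : realType} {d : nat} (u : 'cV[R]_d) : R :=
  Num.sqrt (dotv u u).

Definition quadf {R : realType} {d : nat} (H : 'M[R]_d) (u : 'cV[R]_d) : R :=
  (u^T *m H *m u) 0 0.

(** An orthonormal family indexed by 'I_d is a basis of R^d. *)
Definition orthonormal_basis {R : realType} {d : nat} (e : 'I_d -> 'cV[R]_d) :=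
  forall i j, dotv (e i) (e j) = (i == j)%:R.

(** R^d with its Borel sigma-algebra. *)
Definition borel_cV (R : realType) (d : nat) :=
  g_sigma_algebraType [set A : set 'cV[R]_d | open A].

Section law.
Context {R : realType} {d : nat} {disp : measure_display}
  {T : measurableType disp} (P : probability T R).

Definition marginal (X : {RV P >-> borel_cV R d}) (u : 'cV[R]_d) : T -> R :=
  fun w => dotv u (X w).

Definition entry_prod (X : {RV P >-> borel_cV R d}) (i j : 'I_d) : T -> R :=
  fun w => (X w : 'cV[R]_d) i 0 * (X w : 'cV[R]_d) j 0.

Definition gram_defined (X : {RV P >-> borel_cV R d}) : Prop :=
  forall i j : 'I_d,
    P.-integrable [set: T] (fun w => (entry_prod X i j w)%:E).

Definition gram (X : {RV P >-> borel_cV R d}) : 'M[R]_d :=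
  \matrix_(i, j) fine ('E_P[entry_prod X i j])%E.

Definition kurtosis_sup (X : {RV P >-> borel_cV R d}) : \bar R :=
  ereal_sup [set ('E_P[fun w => (marginal X u w ^+ 4)%R])%E |
    u in [set u : 'cV[R]_d | ('E_P[fun w => (marginal X u w ^+ 2)%R] <= 1)%E]].

Definition mutually_independent (n : nat)
    (Xs : 'I_n -> {RV P >-> borel_cV R d}) : Prop :=
  forall (I : {set 'I_n}) (B : 'I_n -> set (borel_cV R d)),
    (forall i, measurable (B i)) ->
    P [set w | forall i, i \in I -> B i (Xs i w)] =
      (\prod_(i in I) P (Xs i @^-1` B i))%E.

End law.

Definition same_law {R : realType} {d : nat}
    {disp disp' : measure_display}
    {T : measurableType disp} {T' : measurableType disp'}
    (P : probability T R) (P' : probability T' R)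
    (X : {RV P >-> borel_cV R d}) (X' : {RV P' >-> borel_cV R d}) : Prop :=
  forall B : set (borel_cV R d), measurable B ->
    distribution P X B = distribution P' X' B.

Section construction.
Context {R : realType}.

Definition psi (x : R) : R :=
  let psi_nneg y := if 1 <= y then ln 2 else - ln (1 - y + y ^+ 2 / 2) in
  if 0 <= x then psi_nneg x else - psi_nneg (- x).

Definition log_term (d : nat) (eps : R) : R :=
  ln eps^-1 + 73 / 100 * d%:R.

Definition lambda_of (d n : nat) (kappa eps : R) : R :=
  Num.sqrt (2 / ((kappa - 1) * n%:R) * log_term d eps).

Definition mu_of (d n : nat) (kappa eps : R) : R :=
  Num.sqrt (2 * (kappa - 1) / n%:R * log_term d eps)
  + 681 / 100 * Num.sqrt (2 * kappa * d%:R / n%:R).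

Definition delta_of (d n : nat) (kappa eps : R) : R :=
  mu_of d n kappa eps / (1 - 2 * mu_of d n kappa eps).

Definition sample_size_cond (d n : nat) (kappa eps : R) : Prop :=
  n%:R > (20 * Num.sqrt (kappa * d%:R)
          + (5 / 2 + 1 / (2 * (kappa - 1)))
            * Num.sqrt (2 * (kappa - 1) * log_term d eps)) ^+ 2.

Context {d n : nat}.
Implicit Types (x : 'I_n -> 'cV[R]_d) (u : 'cV[R]_d) (H : 'M[R]_d).

(** For lambda >= 0 the set is nonempty (for lambda > 0 the sum tends to
    n * psi (- lambda) < 0 as rho goes to +oo), so the real-valued [inf] is
    the true infimum. *)
Definition Nhat (lambda : R) x u : R :=
  inf [set rho : R | 0 < rho /\
    \sum_(i < n) psi (lambda * (rho^-1 * dotv u (x i) ^+ 2 - 1)) <= 0].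

Definition data_span x : {vspace 'cV[R]_d} := <<codom x>>%VS.

Definition data_sphere x : set 'cV[R]_d :=
  [set u | u \in data_span x /\ enorm u = 1].

(** Extended-real infimum: it is +oo when the data span is {0}. *)
Definition lambda_min_hat (lambda : R) x : \bar R :=
  ereal_inf [set (Nhat lambda x u)%:E | u in data_sphere x].

Definition admissible_radius (lambda delta : R) (e : 'I_d -> 'cV[R]_d) x
    (rho : R) : Prop :=
  0 < rho /\
  (rho%:E <= ediv ((delta ^+ 2)%:E * lambda_min_hat lambda x)
                  (2 * \sum_(i < d) Nhat lambda x (e i))%R%:E)%E.

Definition sphere_net x (rho : R) (Theta : set 'cV[R]_d) : Prop :=
  [/\ finite_set Theta, Theta `<=` data_sphere x &
      forall u, data_sphere x u -> exists2 t, Theta t & enorm (u - t) <= rho].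

Definition feasible (lambda delta : R) x (Theta : set 'cV[R]_d) H : Prop :=
  [/\ H^T = H,
      forall u, H *m u \in data_span x &
      forall t, Theta t ->
        (1 - delta) * Nhat lambda x t <= quadf H t
          <= (1 + delta) * Nhat lambda x t].

(** [H] is a possible output of the construction on the data [x]: the radius,
    the net and the minimizer are free choices. *)
Definition is_Ghat (lambda delta : R) (e : 'I_d -> 'cV[R]_d) x H : Prop :=
  exists (rho : R) (Theta : set 'cV[R]_d),
    [/\ admissible_radius lambda delta e x rho,
        sphere_net x rho Theta,
        feasible lambda delta x Theta H &
        forall H', feasible lambda delta x Theta H' ->
          \tr (H *m H) <= \tr (H' *m H')].

End construction.

(* Main.v *)
Require Import Defs.
From HB Require Import structures.
From mathcomp Require Import all_boot all_order all_algebra.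
From mathcomp Require Import finmap ring lra.
From mathcomp Require Import all_classical all_reals all_analysis.
From mathcomp Require Import measurable_realfun.

Set Implicit Arguments.
Unset Strict Implicit.
Unset Printing Implicit Defensive.

Import Order.TTheory GRing.Theory Num.Theory.
Import numFieldNormedType.Exports.

Local Open Scope classical_set_scope.
Local Open Scope ring_scope.

(** Write N(u) for the quadratic form of the Gram matrix and N^(u) for the
    directional estimate.  The proof has two halves: with probability at least
    1 - 2 eps, the bracket (1 - delta) N^(u) <= N(u) <= (1 + delta) N^(u) holds
    for all u at once and the sample is orthogonal to the kernel of N
    ([uniform_bracket]); and on that event every output of the construction is
    accurate, and there is one ([is_Ghat_bound], [is_Ghat_exists]).

    For a fixed u, the bound exp(psi(h)) <= 1 + h + h^2/2 and the kurtosis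
    assumption control the exponential moments of the sum that defines N^(u),
    and Markov's inequality concludes.  To treat all u together, u is replaced
    by a random vector of mean u, and a PAC-Bayes inequality ([pac_bayes])
    averages the exponential moments over a prior before Markov's inequality
    is used.  The random vectors are built from signs: in a family that is
    orthonormal for N, each coordinate is an average of many independent signs
    whose means encode u.  The prior is then the uniform law on a finite set,
    and the relative entropy is at most the sum of the squared means
    ([sign_exp_entropy]).

    The influence function psi has to be compared with its randomized
    majorant.  If b and c are independent copies of the randomized linear form
    and l = lambda or - lambda, then h = l (b c - 1) has mean
    l (<u, x>^2 - 1) exactly.  The logarithm of 1 + h + h^2/2 is not convex, but
    its concavity costs at most a multiple of the variance of h, and adding
    inside the logarithm a proxy t of this variance, computed from a third
    copy, compensates this cost ([psi_le_perturbed]).  The added terms have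
    degree four in x, so that a bounded kurtosis suffices to integrate them;
    this gives [deviation_bound].  At the precision
    beta = lambda (kappa d n)^(1/2) the entropy and the randomization together
    fit into the 0.73 d added to the logarithm and the term
    6.81 (2 kappa d / n)^(1/2) of mu ([budget]), and the sample size condition
    makes the second order terms smaller than the gap between delta and mu
    ([upper_budget], [lower_budget]).

    For the second half, N^ vanishes orthogonally to the data, so the bracket
    forces the Gram matrix to have its image in the data span: it is feasible.
    A minimizer H therefore has at most the Frobenius norm of the Gram matrix,
    which is at most the sum of the N(e_i).  The radius of the net is small
    compared with the inverse of this sum, so that the comparison of H with
    the Gram matrix on the net extends to the whole sphere of the data span,
    with relative error at most 2 delta / (1 - 2 delta) = 2 mu / (1 - 4 mu).
    Since the sample is orthogonal to the kernel of N, the form N is positive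
    on that sphere; this provides a positive radius, hence a minimizer. *)

(** * The influence function *)

Section scalar.
Context {R : realType}.
Implicit Types x m t w T : R.

Lemma psiN x : psi (- x) = - psi x.
Proof.
rewrite /psi oppr_ge0 opprK.
case: (ltgtP x 0) => [x0|x0|->] //=; rewrite ?opprK //.
by rewrite !oppr0 ler10 !addr0 expr0n /= mul0r addr0 ln1 !oppr0.
Qed.

(** Comparisons of [psi] are made after exponentiation, where both sides are
    rational on each piece. *)
Lemma expR_psi_nneg x : 0 <= x ->
  expR (psi x) = if 1 <= x then 2 else (1 - x + x ^+ 2 / 2)^-1.
Proof.
move=> x0; rewrite /psi x0; case: ifP => _; first by rewrite lnK// posrE.
by rewrite expRN lnK// posrE; nra.
Qed.

Lemma psi_ge0 x : 0 <= x -> 0 <= psi x.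
Proof.
move=> x0; rewrite -ler_expR expR0 expR_psi_nneg//; case: ifP => x1; first by lra.
have d : 0 < 1 - x + x ^+ 2 / 2 by nra.
by rewrite invf_ge1//; nra.
Qed.

Lemma psi_nneg_le x y : 0 <= x -> x <= y -> psi x <= psi y.
Proof.
move=> x0 xy; rewrite -ler_expR !expR_psi_nneg//; last lra.
have d (z : R) : 0 < 1 - z + z ^+ 2 / 2 by nra.
case: (leP 1 x) => x1; case: (leP 1 y) => y1 //; first by lra.
  by rewrite -div1r ler_pdivrMr//; nra.
by rewrite lef_pV2 ?posrE//; nra.
Qed.

Lemma psi_le x y : x <= y -> psi x <= psi y.
Proof.
move=> xy; case: (leP 0 x) => x0; first exact: psi_nneg_le.
have hx : psi x <= 0 by rewrite -oppr_ge0 -psiN psi_ge0//; lra.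
case: (leP 0 y) => y0; first by rewrite (le_trans hx)// psi_ge0.
by rewrite -lerN2 -!psiN psi_nneg_le//; lra.
Qed.

(** Since [expR (psi x)] never exceeds 2, adding a variance proxy [t] inside
    the usual majorant [ln (1 + x + x ^+ 2 / 2)] yields a net gain of
    [ln (1 + t / 2)] whatever [x] is.  This gain pays for randomizing [x]. *)
Lemma psi_ln_gain x t : 0 <= t ->
  psi x + ln (1 + t / 2) <= ln (1 + x + x ^+ 2 / 2 + t).
Proof.
move=> t0.
have p1 : 0 < 1 + t / 2 by lra.
have p2 : 0 < 1 + x + x ^+ 2 / 2 + t by nra.
rewrite -ler_expR expRD !lnK ?posrE//.
case: (leP 0 x) => x0.
  rewrite expR_psi_nneg//; case: ifP => x1; first by nra.
  have d : 0 < 1 - x + x ^+ 2 / 2 by nra.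
  rewrite mulrC ler_pdivrMr//.
  have e : (1 + x + x ^+ 2 / 2 + t) * (1 - x + x ^+ 2 / 2)
    = 1 + x ^+ 4 / 4 + t * (1 - x + x ^+ 2 / 2) by field.
  rewrite e; have : 0 <= x ^+ 4 by apply: exprn_even_ge0.
  have : t * 2^-1 <= t * (1 - x + x ^+ 2 / 2) by apply: ler_wpM2l => //; nra.
  by lra.
have -> : psi x = - psi (- x) by rewrite psiN opprK.
rewrite expRN expR_psi_nneg; last lra.
case: (leP 1 (- x)) => x1; first by nra.
rewrite invrK sqrrN opprK.
have : (1 + x + x ^+ 2 / 2) * t <= 2 * t by apply: ler_wpM2r => //; nra.
by lra.
Qed.

(** The second derivative of [w |-> ln (T + w ^+ 2)] is at least
    [- 1 / (4 * T)] everywhere, so the function stays above the parabola of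
    that curvature tangent to it at any base point [w0]. *)
Lemma ln_sqr_minorant T w0 w : 0 < T ->
  ln (T + w0 ^+ 2) + 2 * w0 / (T + w0 ^+ 2) * (w - w0)
    - (w - w0) ^+ 2 / (8 * T) <= ln (T + w ^+ 2).
Proof.
move=> T0.
have pT (z : R) : 0 < T + z ^+ 2 by have := sqr_ge0 z; lra.
pose k := 2 * w0 / (T + w0 ^+ 2).
pose f (z : R) := ln (T + z ^+ 2) - k * (z - w0) + (z - w0) ^+ 2 / (8 * T).
pose df (z : R) := 2 * z / (T + z ^+ 2) - k + (z - w0) / (4 * T).
have fd (z : R) : is_derive z (1 : R) f (df z).
  have h := is_derive1_ln (pT z).
  have hz : is_derive z (1 : R) (fun y : R => T + y ^+ 2) (2 * z).
    by apply: is_derive_eq; rewrite /GRing.scale /=; ring.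
  have hl : is_derive z (1 : R) (fun y : R => ln (T + y ^+ 2)) (2 * z / (T + z ^+ 2)).
    by have := @is_derive1_comp _ (@ln R) (fun y : R => T + y ^+ 2) z _ _ h hz; rewrite mulrC.
  rewrite /f /df; apply: is_derive_eq.
  rewrite /GRing.scale /= !(mulr1, mul0r, addr0, subr0, expr1, mulr0, oppr0).
  have : T != 0 by lra.
  by move=> T'; congr (_ + _); field.
(* The difference of the two sides decreases up to [w0] and then increases. *)
have sgn (z : R) : 0 <= df z * (z - w0).
  have -> : df z * (z - w0) =
      ((z - w0) ^+ 2 / (4 * T * (T + z ^+ 2) * (T + w0 ^+ 2)))
      * ((z * w0 - 3 * T) ^+ 2 + T * (z - w0) ^+ 2).
    by rewrite /df /k; field; rewrite !gt_eqF.
  apply: mulr_ge0; last by have := sqr_ge0 (z * w0 - 3 * T); have := sqr_ge0 (z - w0); nra.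
  apply: divr_ge0; first exact: sqr_ge0.
  by rewrite ltW// !mulr_gt0.
have fc : continuous f.
  by move=> z; apply: differentiable_continuous; apply/derivable1_diffP; have [] := fd z.
have f0 : f w0 = ln (T + w0 ^+ 2) by rewrite /f; ring.
suff : f w0 <= f w by rewrite f0 /f -/k; lra.
case: (ltgtP w w0) => [lt|lt|->//].
  have [c cI e] := MVT lt (fun x _ => fd x) (continuous_subspaceT fc).
  move: cI; rewrite in_itv /= => /andP[c1 c2].
  have := sgn c => sc.
  have : df c <= 0 by nra.
  by nra.
have [c cI e] := MVT lt (fun x _ => fd x) (continuous_subspaceT fc).
move: cI; rewrite in_itv /= => /andP[c1 c2].
have := sgn c => sc.
have : 0 <= df c by nra.
by nra.
Qed.

(** The proxy [t] flattens the logarithm: the loss of concavity in [x] is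
    divided by [1 + 2 * t], which keeps it below the gain of [psi_ln_gain]
    however large the variance of [x] is. *)
Lemma ln_quad_minorant t m x : 0 <= t ->
  ln (1 + m + m ^+ 2 / 2 + t)
    + (1 + m) / (1 + m + m ^+ 2 / 2 + t) * (x - m)
    - (x - m) ^+ 2 / (8 * (1 + 2 * t)) <= ln (1 + x + x ^+ 2 / 2 + t).
Proof.
move=> t0.
have E (z : R) : 1 + z + z ^+ 2 / 2 + t = ((1 + 2 * t) + (1 + z) ^+ 2) / 2 by field.
have P (z : R) : 0 < (1 + 2 * t) + (1 + z) ^+ 2 by have := sqr_ge0 (1 + z); lra.
have T0 : 0 < 1 + 2 * t by lra.
rewrite !E !ln_div ?posrE//.
have := ln_sqr_minorant (1 + m) (1 + x) T0.
have -> : 1 + x - (1 + m) = x - m by ring.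
have -> : (1 + m) / ((1 + 2 * t + (1 + m) ^+ 2) / 2) = 2 * (1 + m) / (1 + 2 * t + (1 + m) ^+ 2).
  by field; rewrite gt_eqF.
by lra.
Qed.

Lemma ln1p_lb x : 0 <= x -> x / (1 + x) <= ln (1 + x).
Proof.
move=> x0; have p : 0 < 1 + x by lra.
have := @le_ln1Dx _ ((1 + x)^-1 - 1).
have -> : 1 + ((1 + x)^-1 - 1) = (1 + x)^-1 by ring.
rewrite lnV ?posrE//.
have i0 : 0 < (1 + x)^-1 by rewrite invr_gt0.
have -> : x / (1 + x) = 1 - (1 + x)^-1 by field; rewrite gt_eqF.
by lra.
Qed.

End scalar.

(** * Random signs with prescribed means *)

Section signs.
Context {R : realType} {J : finType}.
Implicit Types (m y : J -> R) (s : {ffun J -> bool}) (f g : {ffun J -> bool} -> R).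

Definition sgn (b : bool) : R := (-1) ^+ b.

Definition sign_weight m s : R := \prod_j ((1 + m j * sgn (s j)) / 2).

(** Expectation under independent random signs with means [m]. *)
Definition sign_exp m f : R := \sum_s sign_weight m s * f s.

Definition sign_lin y s : R := \sum_j sgn (s j) * y j.

(** The bounds are strict so that every sign vector has positive weight, hence
    a weight with a logarithm. *)
Definition signed_means m := forall j, `|m j| < 1.

Lemma sign_weight_gt0 m s : signed_means m -> 0 < sign_weight m s.
Proof.
move=> hm; apply: prodr_gt0 => j _; have := hm j; rewrite ltr_norml /sgn => /andP[? ?].
by case: (s j); rewrite /= ?expr1 ?expr0; lra.
Qed.

Lemma sign_exp_prod m (g : J -> bool -> R) :
  sign_exp m (fun s => \prod_j g j (s j)) =
  \prod_j ((1 + m j) / 2 * g j false + (1 - m j) / 2 * g j true).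
Proof.
rewrite /sign_exp /sign_weight.
transitivity (\prod_j \sum_(b : bool) (1 + m j * sgn b) / 2 * g j b).
  by rewrite bigA_distr_bigA; apply: eq_bigr => s _; rewrite -big_split.
apply: eq_bigr => j _; rewrite big_bool /sgn /= expr1 expr0; ring.
Qed.

Lemma sign_exp_cst m (c : R) : sign_exp m (fun=> c) = c.
Proof.
rewrite /sign_exp -mulr_suml.
have -> : \sum_s sign_weight m s = sign_exp m (fun s => \prod_(j : J) 1).
  by apply: eq_bigr => s _; rewrite big1_eq mulr1.
by rewrite (sign_exp_prod m (fun _ _ => 1)) big1 ?mul1r// => j _; field.
Qed.

Lemma eq_sign_exp m f g : f =1 g -> sign_exp m f = sign_exp m g.
Proof. by move=> fg; apply: eq_bigr => s _; rewrite fg. Qed.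

Lemma sign_expD m f g :
  sign_exp m (fun s => f s + g s) = sign_exp m f + sign_exp m g.
Proof. by rewrite /sign_exp -big_split; apply: eq_bigr => s _; rewrite mulrDr. Qed.

Lemma sign_expZ m (c : R) f : sign_exp m (fun s => c * f s) = c * sign_exp m f.
Proof. by rewrite /sign_exp mulr_sumr; apply: eq_bigr => s _; rewrite mulrCA. Qed.

Lemma sign_exp_sum m (I : finType) (F : I -> {ffun J -> bool} -> R) :
  sign_exp m (fun s => \sum_i F i s) = \sum_i sign_exp m (F i).
Proof.
by rewrite /sign_exp exchange_big; apply: eq_bigr => s _; rewrite mulr_sumr.
Qed.

Lemma ler_sign_exp m f g : signed_means m -> (forall s, f s <= g s) ->
  sign_exp m f <= sign_exp m g.
Proof.
move=> hm fg; apply: ler_sum => s _; apply: ler_wpM2l => //.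
exact/ltW/sign_weight_gt0.
Qed.

Lemma sign_exp_gt0 m f : signed_means m -> (forall s, 0 < f s) -> 0 < sign_exp m f.
Proof.
move=> hm f0; rewrite /sign_exp (bigD1 [ffun=> true])//=; apply: ltr_pwDl.
  by rewrite mulr_gt0// sign_weight_gt0.
by apply: sumr_ge0 => s _; rewrite mulr_ge0// ltW// sign_weight_gt0.
Qed.

Lemma signed_means0 : signed_means (fun=> 0).
Proof. by move=> j; rewrite normr0. Qed.

Lemma sign_exp_coord m i (g : bool -> R) :
  sign_exp m (fun s => g (s i)) = (1 + m i) / 2 * g false + (1 - m i) / 2 * g true.
Proof.
have := sign_exp_prod m (fun j b => if j == i then g b else 1).
rewrite (bigD1 i)//= eqxx big1 ?mulr1; last by move=> j /negbTE ->; field.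
move=> <-; apply: eq_sign_exp => s.
by rewrite (bigD1 i)//= eqxx big1 ?mulr1// => j /negbTE ->.
Qed.

Lemma sign_lin_mean m y : sign_exp m (sign_lin y) = \sum_j m j * y j.
Proof.
rewrite sign_exp_sum; apply: eq_bigr => j _.
rewrite (sign_exp_coord m j (fun b => sgn b * y j)) /sgn expr0 expr1.
by field.
Qed.

Lemma sign_lin_var m y : signed_means m ->
  sign_exp m (fun s => (sign_lin y s - \sum_j m j * y j) ^+ 2) <= \sum_j y j ^+ 2.
Proof.
move=> hm.
have E s : (sign_lin y s - \sum_j m j * y j) ^+ 2 =
    \sum_i \sum_j (y i * y j) * ((sgn (s i) - m i) * (sgn (s j) - m j)).
  rewrite -sumrB expr2 mulr_suml; apply: eq_bigr => i _.
  by rewrite mulr_sumr; apply: eq_bigr => j _; ring.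
rewrite (eq_sign_exp m E) sign_exp_sum; apply: ler_sum => i _.
rewrite sign_exp_sum (bigD1 i)//= [X in _ + X]big1 ?addr0 => [|j ji].
  rewrite sign_expZ -expr2 -[leRHS]mulr1.
  apply: ler_wpM2l; first exact: sqr_ge0.
  rewrite (sign_exp_coord m i (fun b => (sgn b - m i) * (sgn b - m i))).
  rewrite /sgn expr0 expr1; have := hm i; rewrite ltr_norml => /andP[? ?]; nra.
(* The product of two centred signs is a product over all coordinates, with a
   vanishing factor at [i]. *)
rewrite sign_expZ.
pose g k b := if k == i then sgn b - m i else if k == j then sgn b - m j else 1.
suff -> : sign_exp m (fun s => (sgn (s i) - m i) * (sgn (s j) - m j)) = 0.
  by rewrite mulr0.
transitivity (sign_exp m (fun s => \prod_k g k (s k))).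
  apply: eq_sign_exp => s; rewrite (bigD1 i)//= (bigD1 j)//= /g eqxx (negbTE ji) eqxx.
  by rewrite big1 ?mulr1// => k /andP[/negbTE -> /negbTE ->].
rewrite sign_exp_prod (bigD1 i)//= /g eqxx /sgn expr0 expr1.
by rewrite [X in X * _](_ : _ = 0) ?mul0r//; field.
Qed.

Lemma sign_weight0 s : sign_weight (fun=> 0) s = \prod_(j : J) 2^-1.
Proof. by apply: eq_bigr => j _; rewrite mul0r addr0 div1r. Qed.

(** Donsker-Varadhan inequality against the uniform law.  The density is
    [\prod_j (1 + m j * s j)], and [ln (1 + u) <= u] bounds the relative
    entropy by [\sum_j m j ^+ 2]. *)
Lemma sign_exp_entropy m f : signed_means m ->
  sign_exp m f <= \sum_j m j ^+ 2 + ln (sign_exp (fun=> 0) (fun s => expR (f s))).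
Proof.
move=> hm; set Z := sign_exp _ (fun s => expR (f s)).
have w0 s : 0 < sign_weight (fun=> 0 : R) s by exact/sign_weight_gt0/signed_means0.
have Z0 : 0 < Z by apply: sign_exp_gt0 signed_means0 _ => s; exact: expR_gt0.
pose D s : R := \prod_j (1 + m j * sgn (s j)).
have m0 s j : 0 < 1 + m j * sgn (s j).
  have := hm j; rewrite ltr_norml /sgn => /andP[? ?].
  by case: (s j); rewrite /= ?expr1 ?expr0; lra.
have D0 s : 0 < D s by apply: prodr_gt0.
have wD s : sign_weight m s = sign_weight (fun=> 0) s * D s.
  by rewrite sign_weight0 -big_split; apply: eq_bigr => j _; rewrite mulrC.
have lnD s : ln (D s) = \sum_j ln (1 + m j * sgn (s j)).
  have [] // : 0 < D s /\ ln (D s) = \sum_j ln (1 + m j * sgn (s j)).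
  rewrite /D; elim/big_rec2 : _ => [|j a b _ [b0 IH]]; first by rewrite ln1.
  by rewrite lnM ?posrE// IH mulr_gt0.
have H : sign_exp m (fun s => f s - ln (D s) - ln Z) <= 0.
  apply: (@le_trans _ _ (\sum_s (sign_weight (fun=> 0) s * expR (f s) / Z - sign_weight m s))).
    apply: ler_sum => s _; rewrite wD.
    have q0 : 0 < expR (f s) / (D s * Z) by rewrite divr_gt0 ?expR_gt0 ?mulr_gt0.
    have := @le_ln1Dx _ (expR (f s) / (D s * Z) - 1).
    rewrite [1 + _]addrC subrK ln_div ?posrE ?expR_gt0 ?mulr_gt0// expRK lnM ?posrE//.
    move=> h; have {}h : f s - ln (D s) - ln Z <= expR (f s) / (D s * Z) - 1.
      by rewrite -addrA -opprD; apply: h; lra.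
    have -> : sign_weight (fun=> 0) s * expR (f s) / Z - sign_weight (fun=> 0) s * D s =
        sign_weight (fun=> 0) s * D s * (expR (f s) / (D s * Z) - 1).
      by field; rewrite !gt_eqF.
    by apply: ler_wpM2l => //; rewrite mulr_ge0// ltW.
  rewrite sumrB -mulr_suml -/Z divff ?gt_eqF//.
  have := sign_exp_cst m 1; rewrite /sign_exp; under eq_bigr do rewrite mulr1.
  by move=> ->; rewrite subrr.
have K : sign_exp m (fun s => ln (D s)) <= \sum_j m j ^+ 2.
  rewrite (eq_sign_exp m lnD) sign_exp_sum; apply: ler_sum => j _.
  apply: (@le_trans _ _ (sign_exp m (fun s => m j * sgn (s j)))).
    by apply: ler_sign_exp => // s; apply: le_ln1Dx; have := m0 s j; lra.
  rewrite sign_expZ (sign_exp_coord m j sgn) /sgn expr0 expr1.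
  by rewrite le_eqVlt; apply/orP; left; apply/eqP; field.
have : sign_exp m (fun s => f s - ln (D s) - ln Z) =
    sign_exp m f - sign_exp m (fun s => ln (D s)) - ln Z.
  rewrite sign_expD sign_exp_cst; congr (_ + _).
  by rewrite -mulN1r -sign_expZ -sign_expD; apply: eq_sign_exp => s; rewrite mulN1r.
by move: H K; lra.
Qed.

End signs.

(** * Randomizing the square of a linear form *)

Section triple.
Context {R : realType} {J : finType}.
Implicit Types (m y : J -> R) (s : {ffun J -> bool}) (l : R).

Definition sign_exp3 m (F : {ffun J -> bool} -> {ffun J -> bool} -> {ffun J -> bool} -> R) :=
  sign_exp m (fun s => sign_exp m (fun s' => sign_exp m (F s s'))).

Definition sign_dev m y s : R := sign_lin y s - \sum_j m j * y j.

Definition sign_var m y : R := sign_exp m (fun s => sign_dev m y s ^+ 2).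

Lemma sign_exp_quad m y (c0 c1 c2 : R) :
  sign_exp m (fun s => c0 + c1 * sign_dev m y s + c2 * sign_dev m y s ^+ 2)
  = c0 + c2 * sign_var m y.
Proof.
rewrite !sign_expD sign_exp_cst !sign_expZ /sign_dev sign_expD sign_exp_cst.
by rewrite sign_lin_mean subrr mulr0 addr0.
Qed.

Lemma sign_var_ge0 m y : signed_means m -> 0 <= sign_var m y.
Proof.
move=> hm; rewrite -[leLHS](sign_exp_cst m); apply: ler_sign_exp => // s.
exact: sqr_ge0.
Qed.

Lemma sign_exp3_entropy m F : signed_means m ->
  sign_exp3 m F <= 3 * \sum_j m j ^+ 2
    + ln (sign_exp3 (fun=> 0) (fun s s' s'' => expR (F s s' s''))).
Proof.
move=> hm; set K := \sum_j _.
have P0 := fun f => @sign_exp_gt0 R J (fun=> 0) f signed_means0.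
pose F2 s s' := ln (sign_exp (fun=> 0) (fun s'' => expR (F s s' s''))).
pose F1 s := ln (sign_exp (fun=> 0) (fun s' => expR (F2 s s'))).
have e2 s s' : expR (F2 s s') = sign_exp (fun=> 0) (fun s'' => expR (F s s' s'')).
  by rewrite lnK// posrE; apply: P0 => s''; exact: expR_gt0.
have e1 s : expR (F1 s) = sign_exp (fun=> 0) (fun s' => expR (F2 s s')).
  by rewrite lnK// posrE; apply: P0 => s''; exact: expR_gt0.
have h2 s s' : sign_exp m (F s s') <= K + F2 s s' by exact: sign_exp_entropy.
have h1 s : sign_exp m (fun s' => sign_exp m (F s s')) <= K + (K + F1 s).
  apply: le_trans (ler_sign_exp hm (h2 s)) _.
  by rewrite sign_expD sign_exp_cst lerD2l; exact: sign_exp_entropy.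
apply: le_trans (ler_sign_exp hm h1) _.
rewrite !sign_expD !sign_exp_cst.
have := sign_exp_entropy F1 hm; rewrite -/K.
have -> : sign_exp (fun=> 0) (fun s => expR (F1 s)) =
    sign_exp3 (fun=> 0) (fun s s' s'' => expR (F s s' s'')).
  by apply: eq_sign_exp => s; rewrite e1; apply: eq_sign_exp => s'; rewrite e2.
by lra.
Qed.

Definition sqnorm y : R := \sum_j y j ^+ 2.

Lemma sqnorm_ge0 y : 0 <= sqnorm y.
Proof. by apply: sumr_ge0 => j _; exact: sqr_ge0. Qed.

(** The product of two independent copies of the linear form is an unbiased
    randomization of its squared mean, so no variance has to be subtracted.
    The variance of that product involves the squared mean itself; a further
    copy, entering only [proxy], stands in for it. *)
Definition proxy l y s : R :=
  3 / 2 * (l ^+ 2 * sqnorm y * sign_lin y s ^+ 2) + 3 * (l ^+ 2 * sqnorm y ^+ 2).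

Definition perturbed l y s s' s'' : R :=
  l * (sign_lin y s' * sign_lin y s'' - 1)
  + (l * (sign_lin y s' * sign_lin y s'' - 1)) ^+ 2 / 2
  + proxy l y s.

Lemma proxy_ge0 l y s : 0 <= proxy l y s.
Proof.
have n0 := sqnorm_ge0 y.
have h1 : 0 <= l ^+ 2 * sqnorm y * sign_lin y s ^+ 2.
  exact: mulr_ge0 (mulr_ge0 (sqr_ge0 _) n0) (sqr_ge0 _).
have h2 : 0 <= l ^+ 2 * sqnorm y ^+ 2 by exact: mulr_ge0 (sqr_ge0 _) (sqr_ge0 _).
by rewrite /proxy; lra.
Qed.

Lemma perturbed_ge_half l y s s' s'' : 2^-1 <= 1 + perturbed l y s s' s''.
Proof.
rewrite /perturbed; have := proxy_ge0 l y s; set h := l * _.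
have := sqr_ge0 (1 + h); rewrite sqrrD; lra.
Qed.

(** At a fixed variance proxy, randomizing the squared linear form loses at
    most the variance of the product, damped by the proxy. *)
Lemma psi_le_perturbed_fixed m y l (a t : R) : signed_means m -> 0 <= t ->
  a = \sum_j m j * y j ->
  psi (l * (a ^+ 2 - 1)) + ln (1 + t / 2)
    - (2 * (l ^+ 2 * sqnorm y * a ^+ 2) + l ^+ 2 * sqnorm y ^+ 2) / (8 * (1 + 2 * t))
  <= sign_exp m (fun s' => sign_exp m (fun s'' =>
       ln (1 + l * (sign_lin y s' * sign_lin y s'' - 1)
           + (l * (sign_lin y s' * sign_lin y s'' - 1)) ^+ 2 / 2 + t))).
Proof.
move=> hm t0 aE; set z := l * (a ^+ 2 - 1).
set k := (1 + z) / (1 + z + z ^+ 2 / 2 + t); set d := (8 * (1 + 2 * t))^-1.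
have d0 : 0 < d by rewrite invr_gt0; lra.
set V := sign_var m y.
have V0 : 0 <= V := sign_var_ge0 y hm.
have Vn : V <= sqnorm y by exact: sign_lin_var.
have L s : sign_lin y s = a + sign_dev m y s by rewrite /sign_dev -aE addrC subrK.
set c := ln (1 + z + z ^+ 2 / 2 + t).
have step s' : c + k * l * (a * sign_dev m y s')
    - d * l ^+ 2 * (a ^+ 2 * sign_dev m y s' ^+ 2 + (a + sign_dev m y s') ^+ 2 * V)
  <= sign_exp m (fun s'' =>
       ln (1 + l * (sign_lin y s' * sign_lin y s'' - 1)
           + (l * (sign_lin y s' * sign_lin y s'' - 1)) ^+ 2 / 2 + t)).
  set u := sign_dev m y s'.
  pose q := sign_exp_quad m y (c + k * l * (a * u) - d * l ^+ 2 * (a ^+ 2 * u ^+ 2))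
   (k * l * (a + u) - d * l ^+ 2 * (2 * a * u * (a + u))) (- d * l ^+ 2 * (a + u) ^+ 2).
  rewrite -/V in q.
  apply: (@le_trans _ _ (c + k * l * (a * u) - d * l ^+ 2 * (a ^+ 2 * u ^+ 2)
     + (- d * l ^+ 2 * (a + u) ^+ 2) * V)); first by lra.
  rewrite -q; apply: ler_sign_exp => // s''.
  have := ln_quad_minorant z (l * (sign_lin y s' * sign_lin y s'' - 1)) t0.
  rewrite -/c -/k -/d; apply: le_trans; rewrite !L -/u /z.
  set v := sign_dev m y s''; set kk := k.
  by rewrite le_eqVlt; apply/orP; left; apply/eqP; ring.
apply: le_trans (ler_sign_exp hm step).
have -> : sign_exp m (fun s' => c + k * l * (a * sign_dev m y s')
    - d * l ^+ 2 * (a ^+ 2 * sign_dev m y s' ^+ 2 + (a + sign_dev m y s') ^+ 2 * V)) =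
    c - d * l ^+ 2 * (a ^+ 2 * V) + (- d * l ^+ 2 * (a ^+ 2 + V)) * V.
  transitivity (sign_exp m (fun s' => (c - d * l ^+ 2 * (a ^+ 2 * V))
      + (k * l * a - d * l ^+ 2 * (2 * a * V)) * sign_dev m y s'
      + (- d * l ^+ 2 * (a ^+ 2 + V)) * sign_dev m y s' ^+ 2)).
    by apply: eq_sign_exp => s'; ring.
  exact: sign_exp_quad.
have g := psi_ln_gain z t0; rewrite -/c in g.
suff : d * l ^+ 2 * (2 * (a ^+ 2 * V) + V ^+ 2) <=
   (2 * (l ^+ 2 * sqnorm y * a ^+ 2) + l ^+ 2 * sqnorm y ^+ 2) * d.
  by move: g; lra.
rewrite [leRHS](_ : _ = d * l ^+ 2 * (2 * (a ^+ 2 * sqnorm y) + sqnorm y ^+ 2)); last by ring.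
apply: ler_wpM2l; first by rewrite mulr_ge0 ?sqr_ge0// ltW.
have := sqr_ge0 a => a0; nra.
Qed.

(** The randomized logarithm dominates the influence function of the squared
    linear form, uniformly in the size of [y]: where the perturbation is large
    the proxy is large too, except on the event that the first copy deviates
    from its mean, which the term [3 * l ^+ 2 * sqnorm y ^+ 2] covers. *)
Lemma psi_le_perturbed m y l (a : R) : signed_means m -> a = \sum_j m j * y j ->
  psi (l * (a ^+ 2 - 1)) <=
  sign_exp3 m (fun s s' s'' => ln (1 + perturbed l y s s' s'')).
Proof.
move=> hm aE.
set S := l ^+ 2 * sqnorm y ^+ 2.
have n0 := sqnorm_ge0 y.
have S0 : 0 <= S by exact: mulr_ge0 (sqr_ge0 _) (sqr_ge0 _).
set e := (2 * (1 + 3 / 2 * S))^-1.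
have e0 : 0 < e by rewrite invr_gt0; lra.
pose w s := l ^+ 2 * sqnorm y * sign_dev m y s ^+ 2.
(* [w s] is the deviation of the copy in the proxy, of mean at most [S]; where
   it is large the proxy may be too small, and [S] compensates on average. *)
have point s : psi (l * (a ^+ 2 - 1)) + (S - w s) * e <=
    sign_exp m (fun s' => sign_exp m (fun s'' => ln (1 + perturbed l y s s' s''))).
  have t0 := proxy_ge0 l y s; set t := proxy l y s in t0 *.
  have -> : sign_exp m (fun s' => sign_exp m (fun s'' => ln (1 + perturbed l y s s' s'')))
     = sign_exp m (fun s' => sign_exp m (fun s'' =>
       ln (1 + l * (sign_lin y s' * sign_lin y s'' - 1)
           + (l * (sign_lin y s' * sign_lin y s'' - 1)) ^+ 2 / 2 + t))).
    apply: eq_sign_exp => s'; apply: eq_sign_exp => s''.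
    by rewrite /perturbed -/t; congr ln; ring.
  apply: le_trans (psi_le_perturbed_fixed l hm t0 aE).
  rewrite -addrA lerD2l -/S.
  set A := l ^+ 2 * sqnorm y * a ^+ 2.
  set u := l ^+ 2 * sqnorm y * sign_lin y s ^+ 2.
  have k0 : 0 <= l ^+ 2 * sqnorm y by exact: mulr_ge0 (sqr_ge0 _) n0.
  have u0 : 0 <= u by exact: mulr_ge0 k0 (sqr_ge0 _).
  have A0 : 0 <= A by exact: mulr_ge0 k0 (sqr_ge0 _).
  have w0 : 0 <= w s by exact: mulr_ge0 k0 (sqr_ge0 _).
  (* The squared mean is recovered from the copy, up to its deviation. *)
  have Au : A <= 2 * u + 2 * w s.
    have -> : 2 * u + 2 * w s = l ^+ 2 * sqnorm y * (2 * sign_lin y s ^+ 2 + 2 * sign_dev m y s ^+ 2).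
      by rewrite /u /w; ring.
    apply: ler_wpM2l => //; rewrite /sign_dev -aE.
    by have := sqr_ge0 (2 * sign_lin y s - a); lra.
  have tE : t = 3 / 2 * u + 3 * S by [].
  set tau := t / 2; have tau0 : 0 <= tau by rewrite /tau; lra.
  have L := ln1p_lb tau0.
  have p1 : 0 < 1 + tau by lra.
  have D : (2 * A + S) / (8 * (1 + 2 * t)) <= (2 * A + S) / 8 * (1 + tau)^-1.
    rewrite -[X in _ <= _ / 8 * X]div1r mulf_div mulr1.
    by apply: ler_wpM2l; [lra | rewrite lef_pV2 ?posrE ?mulr_gt0 //; rewrite /tau; lra].
  apply: (@le_trans _ _ (tau / (1 + tau) - (2 * A + S) / 8 * (1 + tau)^-1)); last by lra.
  rewrite -mulrBl.
  have i0 : 0 < (1 + tau)^-1 by rewrite invr_gt0.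
  apply: (@le_trans _ _ ((tau / 3 - w s / 2) / (1 + tau))); last first.
    by apply: ler_wpM2r; [exact: ltW | rewrite /tau tE; lra].
  have eE : e = (1 + 3 / 2 * S)^-1 / 2 by rewrite /e invfM mulrC.
  have i1 : (1 + tau)^-1 <= (1 + 3 / 2 * S)^-1.
    by rewrite lef_pV2 ?posrE//; [rewrite /tau tE; lra | lra].
  have i2 : 1 - (1 + 3 / 2 * S)^-1 <= 1 - (1 + tau)^-1 by lra.
  have e1 : tau / (1 + tau) = 1 - (1 + tau)^-1 by field; rewrite gt_eqF.
  have e2 : S * (1 + 3 / 2 * S)^-1 = 2 / 3 * (1 - (1 + 3 / 2 * S)^-1).
    by field; rewrite gt_eqF//; lra.
  rewrite eE.
  have : w s * (1 + tau)^-1 <= w s * (1 + 3 / 2 * S)^-1 by exact: ler_wpM2l.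
  by lra.
apply: le_trans (ler_sign_exp hm point).
rewrite sign_expD sign_exp_cst lerDl.
have -> : sign_exp m (fun s => (S - w s) * e) =
    sign_exp m (fun s => S * e + 0 * sign_dev m y s
      + (- (l ^+ 2 * sqnorm y * e)) * sign_dev m y s ^+ 2).
  by apply: eq_sign_exp => s; rewrite /w; ring.
rewrite sign_exp_quad.
rewrite [leRHS](_ : _ = (l ^+ 2 * e) * (sqnorm y * (sqnorm y - sign_var m y))); last by rewrite /S; ring.
apply: mulr_ge0; first exact: mulr_ge0 (sqr_ge0 _) (ltW e0).
by apply: mulr_ge0 => //; rewrite subr_ge0; exact: sign_lin_var.
Qed.

(** Beyond the two terms that would be present without randomization, only
    terms of degree four in [y] and the form appear: a bounded kurtosis is
    enough to integrate them. *)
Lemma perturbed_mean m y l (a : R) : signed_means m -> a = \sum_j m j * y j ->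
  sign_exp3 m (perturbed l y) <=
  l * (a ^+ 2 - 1) + l ^+ 2 / 2 * (a ^+ 2 - 1) ^+ 2
  + 5 / 2 * l ^+ 2 * (sqnorm y * a ^+ 2) + 5 * l ^+ 2 * sqnorm y ^+ 2.
Proof.
move=> hm aE.
set V := sign_var m y.
have V0 : 0 <= V := sign_var_ge0 y hm.
have Vn : V <= sqnorm y by exact: sign_lin_var.
have n0 := sqnorm_ge0 y.
have L s : sign_lin y s = a + sign_dev m y s by rewrite /sign_dev -aE addrC subrK.
have E2 s s' : sign_exp m (perturbed l y s s') =
    proxy l y s + l * (a * (a + sign_dev m y s') - 1)
    + l ^+ 2 / 2 * (a * (a + sign_dev m y s') - 1) ^+ 2
    + l ^+ 2 / 2 * (a + sign_dev m y s') ^+ 2 * V.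
  set u := sign_dev m y s'.
  pose q := sign_exp_quad m y (proxy l y s + l * (a * (a + u) - 1)
     + l ^+ 2 / 2 * (a * (a + u) - 1) ^+ 2)
   (l * (a + u) + l ^+ 2 * (a * (a + u) - 1) * (a + u)) (l ^+ 2 / 2 * (a + u) ^+ 2).
  rewrite -q; apply: eq_sign_exp => s''.
  by rewrite /perturbed !L -/u; set v := sign_dev m y s''; field.
have E1 s : sign_exp m (fun s' => sign_exp m (perturbed l y s s')) =
    proxy l y s + l * (a ^+ 2 - 1) + l ^+ 2 / 2 * (a ^+ 2 - 1) ^+ 2
    + l ^+ 2 / 2 * a ^+ 2 * V + l ^+ 2 / 2 * (a ^+ 2 + V) * V.
  pose q := sign_exp_quad m y (proxy l y s + l * (a ^+ 2 - 1)
     + l ^+ 2 / 2 * (a ^+ 2 - 1) ^+ 2 + l ^+ 2 / 2 * a ^+ 2 * V)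
   (l * a + l ^+ 2 * (a ^+ 2 - 1) * a + l ^+ 2 * a * V) (l ^+ 2 / 2 * (a ^+ 2 + V)).
  rewrite -q; apply: eq_sign_exp => s'.
  by rewrite E2; set v := sign_dev m y s'; field.
have -> : sign_exp3 m (perturbed l y) =
    3 / 2 * (l ^+ 2 * sqnorm y * (a ^+ 2 + V)) + 3 * (l ^+ 2 * sqnorm y ^+ 2)
    + l * (a ^+ 2 - 1) + l ^+ 2 / 2 * (a ^+ 2 - 1) ^+ 2
    + l ^+ 2 / 2 * a ^+ 2 * V + l ^+ 2 / 2 * (a ^+ 2 + V) * V.
  pose q := sign_exp_quad m y (3 / 2 * (l ^+ 2 * sqnorm y * a ^+ 2)
    + 3 * (l ^+ 2 * sqnorm y ^+ 2)
    + l * (a ^+ 2 - 1) + l ^+ 2 / 2 * (a ^+ 2 - 1) ^+ 2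
    + l ^+ 2 / 2 * a ^+ 2 * V + l ^+ 2 / 2 * (a ^+ 2 + V) * V)
    (3 * (l ^+ 2 * sqnorm y * a)) (3 / 2 * (l ^+ 2 * sqnorm y)).
  transitivity (sign_exp m (fun s => 3 / 2 * (l ^+ 2 * sqnorm y * a ^+ 2)
    + 3 * (l ^+ 2 * sqnorm y ^+ 2)
    + l * (a ^+ 2 - 1) + l ^+ 2 / 2 * (a ^+ 2 - 1) ^+ 2
    + l ^+ 2 / 2 * a ^+ 2 * V + l ^+ 2 / 2 * (a ^+ 2 + V) * V
    + 3 * (l ^+ 2 * sqnorm y * a) * sign_dev m y s
    + 3 / 2 * (l ^+ 2 * sqnorm y) * sign_dev m y s ^+ 2)).
    by apply: eq_sign_exp => s; rewrite E1 /proxy L; set v := sign_dev m y s; field.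
  by rewrite q -/V; field.
rewrite -subr_ge0 [leRHS](_ : _ = l ^+ 2 * ((a ^+ 2) * (sqnorm y - V)
   + 3 / 2 * sqnorm y * (sqnorm y - V) + (sqnorm y ^+ 2 - V ^+ 2) / 2)); last by field.
apply: mulr_ge0; first exact: sqr_ge0.
have : 0 <= a ^+ 2 * (sqnorm y - V) by apply: mulr_ge0; [exact: sqr_ge0|lra].
have : 0 <= sqnorm y * (sqnorm y - V) by apply: mulr_ge0; lra.
have : V ^+ 2 <= sqnorm y ^+ 2 by rewrite lerXn2r ?nnegrE.
lra.
Qed.

End triple.

(** * Independence, from sets to functions *)

Section independence.
Context {R : realType} {d d' : measure_display} {T : measurableType d}
  {S : measurableType d'}.
Import HBNNSimple.

(** The hypothesis says that [U], used as a density, does not change the law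
    of [X] except for the total mass [c]; simple functions and monotone
    convergence carry this from sets to functions. *)
Lemma weighted_integral_comp (mu : {measure set T -> \bar R})
    (nu : {measure set S -> \bar R}) (c : R) (U : T -> R) (X : T -> S) (f : S -> R) :
  (0 <= c)%R -> (forall w, 0 <= U w) -> measurable_fun setT U ->
  measurable_fun setT X -> (forall x, 0 <= f x) -> measurable_fun setT f ->
  (forall B, measurable B -> (\int[mu]_w (U w * \1_B (X w))%:E = c%:E * nu B)%E) ->
  (\int[mu]_w (U w * f (X w))%:E = c%:E * \int[nu]_x (f x)%:E)%E.
Proof.
move=> c0 U0 mU mX f0 mf H.
have mEf : measurable_fun setT (fun x => (f x)%:E) by exact/measurable_EFinP.
pose h := nnsfun_approx measurableT mEf.
have hf x : EFin \o h^~ x @ \oo --> (f x)%:E.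
  by apply: (@cvg_nnsfun_approx _ _ _ _ measurableT _ mEf) => // t _; rewrite lee_fin.
have nd x a b : (a <= b)%N -> h a x <= h b x.
  by move=> ab; exact/lefP/nd_nnsfun_approx.
have mh n : measurable_fun setT (h n) by exact: measurable_funP.
have -> : (\int[nu]_x (f x)%:E = lim (\int[nu]_x (h n x)%:E @[n --> \oo]))%E.
  under eq_integral => x _ do rewrite (esym (cvg_lim _ (hf x)))//.
  apply: monotone_convergence => //.
  - by move=> n; apply/measurable_EFinP.
  - by move=> n x _ /=; rewrite lee_fin.
  - by move=> x _ a b ab; rewrite lee_fin; exact: nd.
have -> : (\int[mu]_w (U w * f (X w))%:E = lim (\int[mu]_w (U w * h n (X w))%:E @[n --> \oo]))%E.
  have fg w : (U w * f (X w))%:E = lim ((U w * h n (X w))%:E @[n --> \oo]).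
    apply/esym/cvg_lim => //.
    rewrite EFinM; under eq_fun do rewrite EFinM.
    exact: cvgeZl (hf _).
  under eq_integral => w _ do rewrite fg.
  apply: monotone_convergence => //.
  - move=> n; apply/measurable_EFinP; apply: measurable_funM => //.
    exact: measurableT_comp.
  - by move=> n w _; rewrite lee_fin mulr_ge0.
  - by move=> w _ a b ab; rewrite lee_fin; apply: ler_wpM2l => //; exact: nd.
suff suf n : (\int[mu]_w (U w * h n (X w))%:E = c%:E * \int[nu]_x (h n x)%:E)%E.
  under eq_fun do rewrite suf.
  apply/cvg_lim => //; apply: cvgeZl => //.
  apply: ereal_nondecreasing_is_cvgn => a b ab; apply: ge0_le_integral => //.
  - by move=> x _; rewrite lee_fin.
  - by apply/measurable_EFinP.
  - by apply/measurable_EFinP.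
  - by move=> x _; rewrite lee_fin; exact: nd.
have hE x : h n x = (\sum_(y \in range (h n)) (y * \1_(h n @^-1` [set y]) x))%R.
  by rewrite {1}(fimfunE (h n)).
transitivity (\int[mu]_w (\sum_(y \in range (h n)) (U w * (y * \1_(h n @^-1` [set y]) (X w)))%:E))%E.
  by apply: eq_integral => w _; rewrite hE mulr_fsumr -fsumEFin.
have mI y : measurable (h n @^-1` [set y]) by rewrite -[_ @^-1` _]setTI; exact: mh.
have mUI y : measurable_fun setT (fun w => (U w * (y * \1_(h n @^-1` [set y]) (X w)))%R).
  apply: measurable_funM => //; apply: measurable_funM => //.
  by apply: measurableT_comp mX; exact: measurable_indic.
have ge y x : 0 <= y * \1_(h n @^-1` [set y]) x.
  by have := nnfun_muleindic_ge0 (h n) y x; rewrite lee_fin.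
rewrite ge0_integral_fsum//; first last.
- by move=> y w _; rewrite lee_fin mulr_ge0.
- by move=> y; apply/measurable_EFinP.
have -> : (\int[nu]_x (h n x)%:E =
    \sum_(y \in range (h n)) (y%:E * nu (h n @^-1` [set y])))%E.
  by rewrite integralT_nnsfun sintegralE.
rewrite ge0_mule_fsumr; last by move=> y; exact: nnsfun_mulemu_ge0.
apply: eq_fsbigr => y /set_mem -[x _ <-].
under eq_integral do rewrite mulrCA EFinM.
rewrite ge0_integralZl_EFin//; first by rewrite H// muleCA.
- by move=> w _; rewrite lee_fin mulr_ge0// indicE.
- apply/measurable_EFinP; apply: measurable_funM => //.
  by apply: measurableT_comp mX; exact: measurable_indic.
Qed.

End independence.

Section independence_prod.
Context {R : realType} {d d' : measure_display} {T : measurableType d}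
  {S : measurableType d'}.

(** The indicators are replaced by the functions [f i] one index at a time:
    the product over the other indices is the weight of
    [weighted_integral_comp]. *)
Lemma integral_prod_indep (P : probability T R) (nu : probability S R) (n : nat)
    (Xs : 'I_n -> T -> S) (f : 'I_n -> S -> R) (z : 'I_n -> R) :
  (forall i, measurable_fun setT (Xs i)) ->
  (forall B : 'I_n -> set S, (forall i, measurable (B i)) ->
     P [set w | forall i, B i (Xs i w)] = (\prod_i nu (B i))%E) ->
  (forall i x, 0 <= f i x) -> (forall i, measurable_fun setT (f i)) ->
  (forall i, 0 <= z i) ->
  (forall i, (\int[nu]_x (f i x)%:E = (z i)%:E)%E) ->
  (\int[P]_w (\prod_i f i (Xs i w))%:E = (\prod_i z i)%:E)%E.
Proof.
move=> mX H f0 mf z0 fz.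
have fin B : measurable B -> nu B = (fine (nu B))%:E.
  by move=> mB; rewrite fineK// fin_num_measure.
pose g k (B : 'I_n -> set S) (i : 'I_n) x : R := if (i < k)%N then f i x else \1_(B i) x.
pose c k (B : 'I_n -> set S) (i : 'I_n) : R := if (i < k)%N then z i else fine (nu (B i)).
have g0 k B i x : 0 <= g k B i x by rewrite /g; case: ifP => // _; rewrite indicE.
have mg k B i : (forall i, measurable (B i)) -> measurable_fun setT (g k B i).
  by move=> mB; rewrite /g; case: (i < k)%N; [exact: mf|exact/measurable_indic/mB].
have c0 k B i : 0 <= c k B i by rewrite /c; case: ifP => // _; rewrite fine_ge0.
(* Functions at the indices below [k], indicators at the others. *)
have claim k B : (forall i, measurable (B i)) ->
    (\int[P]_w (\prod_i g k B i (Xs i w))%:E = (\prod_i c k B i)%:E)%E.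
  elim: k B => [|k IH] B mB.
    transitivity (\int[P]_w (\1_[set w | forall i, B i (Xs i w)] w)%:E)%E.
      apply: eq_integral => w _; congr _%:E; rewrite indicE.
      case: (boolP (w \in _)) => [/set_mem h|h].
        by rewrite big1// => i _; rewrite /g ltn0 indicE mem_set.
      have [i hi] : exists i, ~ B i (Xs i w).
        by apply/existsNP => h'; move/negP: h; apply; exact: mem_set.
      by rewrite (bigD1 i)//= /g ltn0 indicE memNset// mul0r.
    rewrite integral_indic//; last first.
      rewrite (_ : [set w | _] = \bigcap_(i in [set: 'I_n]) (Xs i @^-1` B i)); last first.
        by apply/seteqP; split => w h i; [move=> _; exact: h | exact: h].
      apply: fin_bigcap_measurable => // i _.
      by rewrite -[_ @^-1` _]setTI; exact: mX.
    rewrite setIT; transitivity (\prod_i nu (B i))%E; first exact: H.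
    rewrite (eq_bigr (fun i => (c 0 B i)%:E)); last by move=> i _; rewrite {1}fin.
    by rewrite prodEFin.
  case: (ltnP k n) => kn; last first.
    rewrite [RHS](_ : _ = (\prod_i c k B i)%:E); last first.
      congr _%:E; apply: eq_bigr => i _; rewrite /c.
      by rewrite (leq_trans (ltn_ord i) kn) (leq_trans (ltn_ord i) (leqW kn)).
    rewrite -IH//; apply: eq_integral => w _; congr _%:E; apply: eq_bigr => i _.
    by rewrite /g (leq_trans (ltn_ord i) kn) (leq_trans (ltn_ord i) (leqW kn)).
  pose j := Ordinal kn.
  have lt i : i != j -> (i < k.+1)%N = (i < k)%N.
    by move=> ij; rewrite ltnS leq_eqVlt; case: eqP => // e; case/eqP: ij; exact: val_inj.
  pose U w : R := \prod_(i | i != j) g k B i (Xs i w).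
  pose C : R := \prod_(i | i != j) c k B i.
  have mU : measurable_fun setT U.
    rewrite /U; under eq_fun do rewrite -big_filter.
    by apply: measurable_prod => i _; apply: measurableT_comp; [exact: mg|exact: mX].
  rewrite (bigD1 j)//= (_ : c _ _ j = z j); last by rewrite /c ltnSn.
  have -> : \prod_(i | i != j) c k.+1 B i = C.
    by apply: eq_bigr => i ij; rewrite /c lt.
  rewrite mulrC EFinM -fz -(@weighted_integral_comp _ _ _ _ _ P nu C U (Xs j) (f j))//.
  - apply: eq_integral => w _; rewrite (bigD1 j)//= {1}/g ltnSn mulrC; congr (_ * _)%:E.
    by apply: eq_bigr => i ij; rewrite /g lt.
  - by apply: prodr_ge0.
  - by move=> w; apply: prodr_ge0.
  - move=> B0 mB0.
    pose B' i := if i == j then B0 else B i.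
    have mB' i : measurable (B' i) by rewrite /B'; case: ifP.
    transitivity (\int[P]_w (\prod_i g k B' i (Xs i w))%:E)%E.
      have gj : g k B' j =1 \1_B0 by move=> x; rewrite /g /= ltnn /B' eqxx.
      apply: eq_integral => w _; rewrite [in RHS](bigD1 j)//= gj mulrC.
      congr (_ * _)%:E; apply: eq_bigr => i ij; rewrite /g /B' (negbTE ij)//.
    have cj : c k B' j = fine (nu B0) by rewrite /c /= ltnn /B' eqxx.
    rewrite IH// (bigD1 j)//= cj mulrC EFinM -fin//.
    congr (_%:E * _)%E; apply: eq_bigr => i ij; rewrite /c /B' (negbTE ij)//.
have := claim n (fun=> setT) (fun _ => measurableT).
rewrite (eq_bigr z); last by move=> i _; rewrite /c ltn_ord.
move=> <-; apply: eq_integral => w _; congr _%:E.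
by apply: eq_bigr => i _; rewrite /g ltn_ord.
Qed.

End independence_prod.

(** * A PAC-Bayes inequality with a finite prior *)

Section pac_bayes.
Context {R : realType} {d d' : measure_display} {T : measurableType d}
  {S : measurableType d'} {J : finType}.

Lemma integral_sign_exp (mu : {measure set T -> \bar R})
    (f : {ffun J -> bool} -> T -> R) (c : {ffun J -> bool} -> R) :
  (forall s w, 0 <= f s w) -> (forall s, measurable_fun setT (f s)) ->
  (forall s, (\int[mu]_w (f s w)%:E = (c s)%:E)%E) ->
  (\int[mu]_w (sign_exp (fun=> 0) (f^~ w))%:E = (sign_exp (fun=> 0) c)%:E)%E.
Proof.
move=> f0 mf fc.
have w0 s : 0 <= sign_weight (fun=> 0 : R) s :> R.
  exact/ltW/sign_weight_gt0/signed_means0.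
rewrite /sign_exp; under eq_integral do rewrite -sumEFin.
rewrite ge0_integral_sum//; first last.
- by move=> s w _; rewrite lee_fin mulr_ge0.
- by move=> s; apply/measurable_EFinP; apply: measurable_funM.
rewrite -sumEFin; apply: eq_bigr => s _.
under eq_integral do rewrite EFinM.
rewrite ge0_integralZl_EFin//; first by rewrite fc EFinM.
- by move=> w _; rewrite lee_fin.
- exact/measurable_EFinP.
Qed.

Lemma measurable_sign_exp (f : {ffun J -> bool} -> T -> R) (m : J -> R) :
  (forall s, measurable_fun setT (f s)) ->
  measurable_fun setT (fun w => sign_exp m (f^~ w)).
Proof. by move=> mf; apply: measurable_sum => s; exact: measurable_funM. Qed.

Lemma markov_lt (P : probability T R) (A : T -> R) (eps : R) :
  0 < eps -> (forall w, 0 <= A w) -> measurable_fun setT A ->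
  (\int[P]_w (A w)%:E = 1)%E ->
  measurable [set w | A w < eps^-1] /\
  ((1 - eps)%R%:E <= P [set w | (A w < eps^-1)%R])%E.
Proof.
move=> e0 A0 mA int1.
pose B := [set w | eps^-1 <= A w].
have mB : measurable B.
  have := mA measurableT `[eps^-1, +oo[%classic (measurable_itv _).
  rewrite setTI; congr measurable; apply/seteqP; split => w /=; by rewrite in_itv/= andbT.
have -> : [set w | A w < eps^-1] = ~` B.
  by apply/seteqP; split => w /=; [rewrite ltNge => /negP|move/negP; rewrite -ltNge].
split; first exact: measurableC.
rewrite probability_setC// EFinB; apply: leeB => //.
suff : (eps^-1%:E * P B <= 1)%E.
  move=> h; rewrite -(@lee_pmul2l _ eps^-1%:E) ?lte_fin ?invr_gt0//.
  by apply: le_trans h _; rewrite -EFinM mulVf// gt_eqF.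
rewrite -int1 -[P B]mul1e -(setIT B) -integral_indic//.
have ei : 0 <= eps^-1 by rewrite invr_ge0 ltW.
have mI : measurable_fun setT (fun w => (\1_B w : R)%:E).
  by apply/measurable_EFinP; exact: measurable_indic.
rewrite mul1e -ge0_integralZl_EFin//.
apply: ge0_le_integral => //.
- by move=> w _; rewrite lee_fin mulr_ge0.
- by apply/measurable_EFinP; apply: measurable_funM => //; exact: measurable_indic.
- exact/measurable_EFinP.
- move=> w _; rewrite -EFinM lee_fin indicE; case: (boolP (w \in B)) => [/set_mem|_].
    by rewrite mulr1.
  by rewrite mulr0.
Qed.

(** PAC-Bayes inequality with a finite prior: averaging the exponential moments
    under the prior before applying Markov's inequality makes the bound hold
    simultaneously for all means [m]. *)
Lemma pac_bayes (P : probability T R) (nu : probability S R) (n : nat)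
    (Xs : 'I_n -> T -> S)
    (F : {ffun J -> bool} -> {ffun J -> bool} -> {ffun J -> bool} -> S -> R) (eps : R) :
  0 < eps ->
  (forall i, measurable_fun setT (Xs i)) ->
  (forall B : 'I_n -> set S, (forall i, measurable (B i)) ->
     P [set w | forall i, B i (Xs i w)] = (\prod_i nu (B i))%E) ->
  (forall s s' s'' x, 2^-1 <= 1 + F s s' s'' x) ->
  (forall s s' s'', nu.-integrable setT (EFin \o F s s' s'')) ->
  exists E : set T, [/\ measurable E, ((1 - eps)%R%:E <= P E)%E &
    forall w, E w -> forall m : J -> R, signed_means m ->
      sign_exp3 m (fun s s' s'' => \sum_i ln (1 + F s s' s'' (Xs i w))) <=
      3 * (\sum_j m j ^+ 2) + ln eps^-1
      + n%:R * sign_exp3 m (fun s s' s'' => \int[nu]_x F s s' s'' x)].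
Proof.
move=> e0 mX indep F2 iF.
pose z s s' s'' := \int[nu]_x F s s' s'' x.
have mF s s' s'' : measurable_fun setT (F s s' s'').
  by have /integrableP[/measurable_EFinP] := iF s s' s''.
have mF1 s s' s'' : measurable_fun setT (fun x => 1 + F s s' s'' x).
  by apply: measurable_funD.
have i1 s s' s'' : (\int[nu]_x (1 + F s s' s'' x)%:E = (1 + z s s' s'')%:E)%E.
  have ic : nu.-integrable setT (EFin \o (fun _ : S => 1 : R)).
    exact: finite_measure_integrable_cst.
  have i2 : nu.-integrable setT (EFin \o (fun x => 1 + F s s' s'' x)).
    rewrite (_ : EFin \o _ = (EFin \o (fun _ : S => 1 : R)) \+ (EFin \o F s s' s'')).
      exact: integrableD.
    by apply/funext => x /=; rewrite EFinD.
  rewrite -[LHS]fineK; last exact: integrable_fin_num.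
  congr _%:E; rewrite -[LHS]/(Rintegral _ _ _) RintegralD// Rintegral_cst//.
  have nuT : fine (nu [set: S]) = 1 by rewrite probability_setT.
  by rewrite nuT mul1r.
have z1 s s' s'' : 2^-1 <= 1 + z s s' s''.
  rewrite -lee_fin -i1 -[leLHS]mule1 -(@probability_setT _ _ _ nu) -integral_cst//.
  apply: ge0_le_integral => //.
  - by move=> x _ /=; rewrite lee_fin invr_ge0.
  - exact/measurable_EFinP.
  - by move=> x _ /=; rewrite lee_fin.
have z0 s s' s'' : 0 < 1 + z s s' s'' by have := z1 s s' s''; lra.
have F0 s s' s'' x : 0 < 1 + F s s' s'' x by have := F2 s s' s'' x; lra.
pose W s s' s'' w := \prod_i ((1 + F s s' s'' (Xs i w)) / (1 + z s s' s'')).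
have W0 s s' s'' w : 0 < W s s' s'' w by apply: prodr_gt0 => i _; rewrite divr_gt0.
have mW s s' s'' : measurable_fun setT (W s s' s'').
  apply: measurable_prod => i _; apply: measurable_funM => //.
  exact: (measurableT_comp (mF1 s s' s'')).
have iW s s' s'' : (\int[P]_w (W s s' s'' w)%:E = 1%:E)%E.
  rewrite (@integral_prod_indep _ _ _ _ _ P nu n Xs
    (fun _ x => (1 + F s s' s'' x) / (1 + z s s' s'')) (fun=> 1))//.
  - by rewrite big1_eq.
  - by move=> _ x; rewrite divr_ge0// ltW.
  - by move=> _; apply: measurable_funM.
  - move=> _; under eq_integral do rewrite mulrC EFinM.
    rewrite ge0_integralZl_EFin//; first by rewrite i1 -EFinM mulVf// gt_eqF.
    + by move=> x _; rewrite lee_fin ltW.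
    + exact/measurable_EFinP.
    + by rewrite invr_ge0 ltW.
(* The exponential moments, normalized to have mean one, averaged over the
   prior. *)
pose A w := sign_exp3 (fun=> 0) (fun s s' s'' => W s s' s'' w).
have p0 : signed_means (fun=> 0 : R) (J := J) by exact: signed_means0.
have A0 w : 0 < A w by do 3! (apply: sign_exp_gt0 => // ?).
have mA : measurable_fun setT A.
  by do 3! (apply: measurable_sign_exp => ?).
have iA : (\int[P]_w (A w)%:E = 1)%E.
  rewrite (_ : 1%E = (sign_exp3 (fun=> 0 : R) (fun _ _ _ : {ffun J -> bool} => 1 : R))%:E); last first.
    by rewrite /sign_exp3 !sign_exp_cst.
  apply: (integral_sign_exp (f := fun s w => sign_exp (fun=> 0) (fun s' => sign_exp (fun=> 0)
     (fun s'' => W s s' s'' w)))) => [s w|s|s].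
  - by apply/ltW; do 2! (apply: sign_exp_gt0 => // ?).
  - by do 2! (apply: measurable_sign_exp => ?).
  apply: (integral_sign_exp (f := fun s' w => sign_exp (fun=> 0)
     (fun s'' => W s s' s'' w))) => [s' w|s'|s'].
  - by apply/ltW; apply: sign_exp_gt0.
  - exact: measurable_sign_exp.
  by apply: integral_sign_exp => [s'' w|s''|s'']; [exact: ltW| |exact: iW].
have [mE PE] := markov_lt e0 (fun w => ltW (A0 w)) mA iA.
exists [set w | A w < eps^-1]; split => // w /= Aw m hm.
have := sign_exp3_entropy (fun s s' s'' => ln (W s s' s'' w)) hm.
have -> : sign_exp3 (fun=> 0) (fun s s' s'' => expR (ln (W s s' s'' w))) = A w.
  by do 3! (apply: eq_sign_exp => ?); rewrite lnK// posrE.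
have lnW s s' s'' : ln (W s s' s'' w) =
   \sum_i ln (1 + F s s' s'' (Xs i w)) - n%:R * ln (1 + z s s' s'').
  have -> : n%:R * ln (1 + z s s' s'') = \sum_(i < n) ln (1 + z s s' s'').
    by rewrite sumr_const card_ord mulr_natl.
  rewrite -sumrB.
  have [] // : 0 < W s s' s'' w /\ ln (W s s' s'' w) =
     \sum_i (ln (1 + F s s' s'' (Xs i w)) - ln (1 + z s s' s'')).
  rewrite /W; elim/big_rec2 : _ => [|i a b _ [b0 IH]]; first by rewrite ln1.
  by rewrite lnM ?posrE ?divr_gt0// ln_div ?posrE// IH; split => //; rewrite mulr_gt0 ?divr_gt0.
have lnA : ln (A w) <= ln eps^-1.
  by rewrite ler_ln ?posrE ?invr_gt0// ltW.
move=> H.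
have {}H : sign_exp3 m (fun s s' s'' => ln (W s s' s'' w)) <=
  3 * (\sum_j m j ^+ 2) + ln eps^-1 by apply: le_trans H _; rewrite lerD2l.
have step : sign_exp3 m (fun s s' s'' => \sum_i ln (1 + F s s' s'' (Xs i w))) <=
   sign_exp3 m (fun s s' s'' => ln (W s s' s'' w) + n%:R * z s s' s'').
  apply: ler_sign_exp => // s; apply: ler_sign_exp => // s'; apply: ler_sign_exp => // s''.
  rewrite lnW -addrA lerDl addrC subr_ge0; apply: ler_wpM2l => //.
  by apply: le_ln1Dx; have := z0 s s' s''; lra.
apply: le_trans step _.
have -> : sign_exp3 m (fun s s' s'' => ln (W s s' s'' w) + n%:R * z s s' s'') =
  sign_exp3 m (fun s s' s'' => ln (W s s' s'' w)) + n%:R * sign_exp3 m z.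
  rewrite /sign_exp3 -sign_expZ -sign_expD; apply: eq_sign_exp => s.
  rewrite -sign_expZ -sign_expD; apply: eq_sign_exp => s'.
  by rewrite -sign_expZ -sign_expD.
by rewrite lerD2r.
Qed.

End pac_bayes.

(** * Linear forms on Euclidean space *)

Section linear_forms.
Context {R : realType} {d : nat}.
Implicit Types u v x : 'cV[R]_d.

Lemma dotvE u v : dotv u v = \sum_i u i 0 * v i 0.
Proof. by rewrite /dotv mxE; apply: eq_bigr => i _; rewrite mxE. Qed.

Lemma dotvC u v : dotv u v = dotv v u.
Proof. by rewrite !dotvE; apply: eq_bigr => i _; rewrite mulrC. Qed.

Lemma dotvDl u v x : dotv (u + v) x = dotv u x + dotv v x.
Proof. by rewrite /dotv linearD mulmxDl mxE. Qed.

Lemma dotvZl (c : R) u x : dotv (c *: u) x = c * dotv u x.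
Proof. by rewrite /dotv linearZ /= -scalemxAl mxE. Qed.

Lemma dotv_suml (I : Type) (r : seq I) (Q : pred I) (F : I -> 'cV[R]_d) x :
  dotv (\sum_(i <- r | Q i) F i) x = \sum_(i <- r | Q i) dotv (F i) x.
Proof.
elim/big_rec2 : _ => [|i a b _ <-]; last by rewrite dotvDl.
by rewrite /dotv trmx0 mul0mx mxE.
Qed.

Lemma dotv_ge0 u : 0 <= dotv u u.
Proof. by rewrite dotvE; apply: sumr_ge0 => i _; exact: sqr_ge0. Qed.

Lemma measurable_dotv u : measurable_fun setT (dotv u : borel_cV R d -> R).
Proof.
have mc i : measurable_fun setT ((fun x : 'cV[R]_d => x i 0) : borel_cV R d -> R).
  apply: (measurability _ (RGenOInfty.measurableE R)).
  move=> _ [_ [a ->] <-]; rewrite setTI.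
  apply: sub_sigma_algebra => /=.
  have : open (`]a, +oo[%classic : set R) by exact: interval_open.
  by apply: open_comp => x _; exact: coord_continuous.
rewrite (_ : dotv u = fun x => \sum_i u i 0 * x i 0); last by apply/funext => x; rewrite dotvE.
by apply: measurable_sum => i; apply: measurable_funM.
Qed.

End linear_forms.

(** * Means of integrable functions *)

Section moments.
Context {R : realType} {d' : measure_display} {S : measurableType d'}.
Variable nu : probability S R.
Implicit Types f g : S -> R.

Definition intg f : Prop := nu.-integrable setT (EFin \o f).

Lemma intg_cst (c : R) : intg (fun=> c).
Proof. exact: finite_measure_integrable_cst. Qed.

Lemma intgD f g : intg f -> intg g -> intg (fun x => f x + g x).
Proof.
move=> hf hg; rewrite /intg (_ : EFin \o _ = (EFin \o f) \+ (EFin \o g)).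
  exact: integrableD.
by apply/funext => x /=; rewrite EFinD.
Qed.

Lemma intgZ (c : R) f : intg f -> intg (fun x => c * f x).
Proof.
move=> hf; rewrite /intg (_ : EFin \o _ = (fun x => c%:E * (EFin \o f) x)%E).
  exact: integrableZl.
by apply/funext => x /=; rewrite EFinM.
Qed.

Lemma intg_sum (I : finType) (F : I -> S -> R) :
  (forall i, intg (F i)) -> intg (fun x => \sum_i F i x).
Proof.
move=> hF; rewrite /intg (_ : EFin \o _ = (fun x => \sum_i (EFin \o F i) x)%E).
  by apply: integrable_sum => // i _; exact: hF.
by apply/funext => x /=; rewrite sumEFin.
Qed.

Lemma intg_le f g : measurable_fun setT f -> (forall x, `|f x| <= g x) ->
  intg g -> intg f.
Proof.
move=> mf fg; apply: le_integrable => //; first exact/measurable_EFinP.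
by move=> x _ /=; rewrite lee_fin (le_trans (fg x))// ler_norm.
Qed.

Lemma eq_intg f g : f =1 g -> intg f -> intg g.
Proof. by move=> /funext ->. Qed.

Lemma mean_cst (c : R) : \int[nu]_x c = c.
Proof.
have nuT : fine (nu [set: S]) = 1 by rewrite probability_setT.
by rewrite Rintegral_cst// nuT mulr1.
Qed.

Lemma meanD f g : intg f -> intg g ->
  \int[nu]_x (f x + g x) = \int[nu]_x f x + \int[nu]_x g x.
Proof. by move=> hf hg; rewrite RintegralD. Qed.

Lemma meanZ (c : R) f : intg f -> \int[nu]_x (c * f x) = c * \int[nu]_x f x.
Proof. by move=> hf; rewrite RintegralZl. Qed.

Lemma ler_mean f g : intg f -> intg g -> (forall x, f x <= g x) ->
  \int[nu]_x f x <= \int[nu]_x g x.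
Proof. by move=> hf hg fg; apply: le_Rintegral. Qed.

Lemma mean_sum (I : finType) (F : I -> S -> R) : (forall i, intg (F i)) ->
  \int[nu]_x (\sum_i F i x) = \sum_i \int[nu]_x F i x.
Proof.
move=> hF; rewrite /Rintegral.
under eq_integral do rewrite -sumEFin.
rewrite integral_sum//.
rewrite (eq_bigr (fun i => (fine (\int[nu]_x (F i x)%:E))%:E)) ?sumEFin// => i _.
by rewrite fineK//; apply: integrable_fin_num => //; exact: hF.
Qed.

Lemma intg_sign_exp (J : finType) (m : J -> R) (F : {ffun J -> bool} -> S -> R) :
  (forall s, intg (F s)) -> intg (fun x => sign_exp m (F^~ x)).
Proof. by move=> hF; apply: intg_sum => s; exact: intgZ. Qed.

Lemma mean_sign_exp (J : finType) (m : J -> R) (F : {ffun J -> bool} -> S -> R) :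
  (forall s, intg (F s)) ->
  \int[nu]_x sign_exp m (F^~ x) = sign_exp m (fun s => \int[nu]_x F s x).
Proof.
move=> hF; rewrite /sign_exp mean_sum; last by move=> s; exact: intgZ.
by apply: eq_bigr => s _; rewrite meanZ.
Qed.

End moments.

(** * Deviations uniform over all directions *)

Section deviations.
Context {R : realType} {d : nat}.
Variables (nu : probability (borel_cV R d) R) (kappa : R).

Hypothesis int4 : forall u, intg nu (fun x : borel_cV R d => dotv u x ^+ 4).

Lemma intg_dotv4 a b c e :
  intg nu (fun x : borel_cV R d => dotv a x * dotv b x * (dotv c x * dotv e x)).
Proof.
apply: (@intg_le _ _ _ _ _ (fun x : borel_cV R d => (dotv a x ^+ 4 + dotv b x ^+ 4)
   + (dotv c x ^+ 4 + dotv e x ^+ 4))).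
- by apply: measurable_funM; apply: measurable_funM; exact: measurable_dotv.
- move=> x; move: (dotv a x) (dotv b x) (dotv c x) (dotv e x) => p q r s.
  have h (y z : R) : `|y * z| <= (y ^+ 2 + z ^+ 2) / 2.
    by rewrite ler_norml; have := sqr_ge0 (y + z); have := sqr_ge0 (y - z);
      rewrite !expr2 => ? ?; apply/andP; split; nra.
  have h2 (y z : R) : (y * z) ^+ 2 <= (y ^+ 4 + z ^+ 4) / 2.
    rewrite -subr_ge0 [leRHS](_ : _ = (y ^+ 2 - z ^+ 2) ^+ 2 / 2); last by field.
    by rewrite divr_ge0 ?sqr_ge0.
  apply: le_trans (h _ _) _; have := h2 p q; have := h2 r s.
  have e4 (y : R) : 0 <= y ^+ 4 by apply: exprn_even_ge0.
  have := e4 p; have := e4 q; have := e4 r; have := e4 s.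
  by lra.
- by do ! apply: intgD.
Qed.

Lemma intg_dotv2 a b : intg nu (fun x : borel_cV R d => dotv a x * dotv b x).
Proof.
apply: (@intg_le _ _ _ _ _ (fun x : borel_cV R d => 1 + (dotv a x ^+ 4 + dotv b x ^+ 4))).
- by apply: measurable_funM; exact: measurable_dotv.
- move=> x; move: (dotv a x) (dotv b x) => p q.
  have h (y z : R) : `|y * z| <= (y ^+ 2 + z ^+ 2) / 2.
    by rewrite ler_norml; have := sqr_ge0 (y + z); have := sqr_ge0 (y - z);
      rewrite !expr2 => ? ?; apply/andP; split; nra.
  apply: le_trans (h _ _) _.
  have e4 (y : R) : y ^+ 4 = (y ^+ 2) ^+ 2 by rewrite -exprM.
  have := sqr_ge0 (p ^+ 2 - 1); have := sqr_ge0 (q ^+ 2 - 1); rewrite !sqrrB -!e4.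
  have := sqr_ge0 p; have := sqr_ge0 q.
  have := @exprn_even_ge0 _ 4 p isT; have := @exprn_even_ge0 _ 4 q isT.
  by lra.
- by apply: intgD; [exact: intg_cst|exact: intgD].
Qed.

Lemma intg_dotv2_sqr a b : intg nu (fun x : borel_cV R d => dotv a x ^+ 2 * dotv b x ^+ 2).
Proof. exact: eq_intg (intg_dotv4 a a b b). Qed.

Definition law_gram u v : R := \int[nu]_x (dotv u x * dotv v x).

Hypothesis kurtosis : forall u s, 0 < s -> law_gram u u <= s ->
  \int[nu]_x (dotv u x ^+ 4) <= kappa * s ^+ 2.

(** The weights [s] and [t] in the arithmetic-geometric inequality make both
    fourth moments contribute equally. *)
Lemma mean_dotv2_sqr a b s t : 0 < s -> 0 < t -> law_gram a a <= s -> law_gram b b <= t ->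
  \int[nu]_x (dotv a x ^+ 2 * dotv b x ^+ 2) <= kappa * (s * t).
Proof.
move=> s0 t0 ha hb.
apply: (@le_trans _ _ (\int[nu]_x (t / s / 2 * dotv a x ^+ 4 + s / t / 2 * dotv b x ^+ 4))).
  apply: ler_mean; first exact: intg_dotv2_sqr.
    by apply: intgD; exact: intgZ.
  move=> x; move: (dotv a x) (dotv b x) => p q; rewrite -subr_ge0.
  rewrite [leRHS](_ : _ = (t * p ^+ 2 - s * q ^+ 2) ^+ 2 / (2 * (s * t))).
    by rewrite divr_ge0 ?sqr_ge0// !mulr_ge0// ltW.
  by field; rewrite !gt_eqF.
rewrite meanD; [|exact: intgZ..]; rewrite !meanZ//.
have h1 := kurtosis s0 ha; have h2 := kurtosis t0 hb.
have k1 : t / s / 2 * \int[nu]_x (dotv a x ^+ 4) <= t / s / 2 * (kappa * s ^+ 2).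
  by apply: ler_wpM2l => //; rewrite !divr_ge0// ltW.
have k2 : s / t / 2 * \int[nu]_x (dotv b x ^+ 4) <= s / t / 2 * (kappa * t ^+ 2).
  by apply: ler_wpM2l => //; rewrite !divr_ge0// ltW.
apply: le_trans (lerD k1 k2) _.
by rewrite le_eqVlt; apply/orP; left; apply/eqP; field; rewrite !gt_eqF.
Qed.

Section family.
Context {r : nat}.
Variable U : 'I_r -> 'cV[R]_d.
Hypothesis orthoU : forall i j, law_gram (U i) (U j) = (i == j)%:R.
Implicit Types th : 'I_r -> R.

Definition comb th : 'cV[R]_d := \sum_j th j *: U j.

Definition sqcoord (x : 'cV[R]_d) : R := \sum_j dotv (U j) x ^+ 2.

Lemma dotv_comb th x : dotv (comb th) x = \sum_j th j * dotv (U j) x.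
Proof. by rewrite /comb dotv_suml; apply: eq_bigr => j _; rewrite dotvZl. Qed.

Lemma law_gram_comb th : law_gram (comb th) (comb th) = \sum_j th j ^+ 2.
Proof.
rewrite /law_gram.
transitivity (\int[nu]_x (\sum_i \sum_j (th i * th j) * (dotv (U i) x * dotv (U j) x))).
  apply: eq_Rintegral => x _; rewrite dotv_comb mulr_suml; apply: eq_bigr => i _.
  by rewrite mulr_sumr; apply: eq_bigr => j _; ring.
have iU i j : intg nu (fun x : borel_cV R d => th i * th j * (dotv (U i) x * dotv (U j) x)).
  by apply: intgZ; exact: intg_dotv2.
rewrite mean_sum; last by move=> i; exact: intg_sum.
apply: eq_bigr => i _; rewrite mean_sum//.
rewrite (bigD1 i)//= [X in _ + X]big1 ?addr0 => [|j ji].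
  rewrite meanZ; last exact: intg_dotv2.
  by rewrite -/(law_gram _ _) orthoU eqxx mulr1 expr2.
rewrite meanZ; last exact: intg_dotv2.
by rewrite -/(law_gram _ _) orthoU eq_sym (negbTE ji) mulr0.
Qed.

Lemma mean_sqcoord_dotv2 b t : 0 < t -> law_gram b b <= t ->
  \int[nu]_x (sqcoord x * dotv b x ^+ 2) <= kappa * (r%:R * t).
Proof.
move=> t0 hb.
have -> : \int[nu]_x (sqcoord x * dotv b x ^+ 2)
    = \int[nu]_x (\sum_j dotv (U j) x ^+ 2 * dotv b x ^+ 2).
  by apply: eq_Rintegral => x _; rewrite /sqcoord mulr_suml.
rewrite mean_sum; last by move=> j; exact: intg_dotv2_sqr.
apply: (@le_trans _ _ (\sum_(j < r) kappa * (1 * t))).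
  by apply: ler_sum => j _; apply: mean_dotv2_sqr => //; rewrite orthoU eqxx.
rewrite sumr_const card_ord -mulr_natl le_eqVlt; apply/orP; left; apply/eqP; ring.
Qed.

Lemma intg_sqcoord_dotv2 b : intg nu (fun x : borel_cV R d => sqcoord x * dotv b x ^+ 2).
Proof.
apply: (@eq_intg _ _ _ _ (fun x : borel_cV R d => \sum_j dotv (U j) x ^+ 2 * dotv b x ^+ 2)).
  by move=> x; rewrite /sqcoord mulr_suml.
by apply: intg_sum => j; exact: intg_dotv2_sqr.
Qed.

Lemma sqcoord2E x : sqcoord x ^+ 2 = \sum_j sqcoord x * dotv (U j) x ^+ 2.
Proof. by rewrite expr2 {2}/sqcoord mulr_sumr. Qed.

Lemma intg_sqcoord2 : intg nu (fun x : borel_cV R d => sqcoord x ^+ 2).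
Proof.
apply: (@eq_intg _ _ _ _ (fun x : borel_cV R d => \sum_j sqcoord x * dotv (U j) x ^+ 2)).
  by move=> x; rewrite sqcoord2E.
by apply: intg_sum => j; exact: intg_sqcoord_dotv2.
Qed.

Lemma mean_sqcoord2 : \int[nu]_x (sqcoord x ^+ 2) <= kappa * r%:R ^+ 2.
Proof.
have -> : \int[nu]_x (sqcoord x ^+ 2)
    = \int[nu]_x (\sum_j sqcoord x * dotv (U j) x ^+ 2).
  by apply: eq_Rintegral => x _; rewrite sqcoord2E.
rewrite mean_sum; last by move=> j; exact: intg_sqcoord_dotv2.
apply: (@le_trans _ _ (\sum_(j < r) kappa * (r%:R * 1))).
  by apply: ler_sum => j _; apply: mean_sqcoord_dotv2 => //; rewrite orthoU eqxx.
rewrite sumr_const card_ord -mulr_natl le_eqVlt; apply/orP; left; apply/eqP; ring.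
Qed.

(** Each coordinate of the direction is encoded by the average of [M] signs
    scaled by [B], with [B ^+ 2 = M / beta].  Then [beta ^-1] bounds the
    variance of a coordinate, and [beta] is also the factor between the squared
    length of the direction and the entropy bound; [M] only has to be so large
    that the means are feasible. *)
Lemma deviation_bound {disp} {T : measurableType disp} (P : probability T R)
    (n : nat) (Xs : 'I_n -> T -> borel_cV R d) (l beta eps : R) (M : nat) :
  (forall i, measurable_fun setT (Xs i)) ->
  (forall B : 'I_n -> set (borel_cV R d), (forall i, measurable (B i)) ->
     P [set w | forall i, B i (Xs i w)] = (\prod_i nu (B i))%E) ->
  0 < eps -> 0 < beta -> (0 < M)%N ->
  exists E : set T, [/\ measurable E, ((1 - eps)%R%:E <= P E)%E &
    forall w, E w -> forall th s, s = \sum_j th j ^+ 2 -> 0 < s -> beta * s < M%:R ->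
    \sum_i psi (l * (dotv (comb th) (Xs i w) ^+ 2 - 1)) <=
    3 * (beta * s) + ln eps^-1 +
    n%:R * (l * (s - 1) + l ^+ 2 / 2 * ((kappa - 1) * s ^+ 2 + (s - 1) ^+ 2)
      + 5 / 2 * l ^+ 2 * (kappa * (r%:R * s) / beta)
      + 5 * l ^+ 2 * (kappa * r%:R ^+ 2 / beta ^+ 2))].
Proof.
move=> mX indep e0 be0 M0.
have M0' : 0 < M%:R :> R by rewrite ltr0n.
pose B := Num.sqrt (M%:R / beta).
have B0 : 0 < B by rewrite sqrtr_gt0 divr_gt0.
have B2 : B ^+ 2 = M%:R / beta by rewrite sqr_sqrtr// divr_ge0// ltW.
pose y (x : borel_cV R d) (p : 'I_r * 'I_M) : R := B / M%:R * dotv (U p.1) x.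
have sumM (f : 'I_r -> R) : \sum_(p : 'I_r * 'I_M) f p.1 = M%:R * \sum_j f j.
  rewrite -(pair_bigA _ (fun j (_ : 'I_M) => f j)) /= mulr_sumr.
  by apply: eq_bigr => j _; rewrite sumr_const card_ord mulr_natl.
have sqy x : sqnorm (y x) = beta^-1 * sqcoord x.
  rewrite /sqnorm (sumM (fun j => (B / M%:R * dotv (U j) x) ^+ 2)).
  under eq_bigr do rewrite exprMn; rewrite -mulr_sumr mulrA; congr (_ * _).
  by rewrite exprMn B2; field; rewrite !gt_eqF.
pose V (s : {ffun 'I_r * 'I_M -> bool}) : 'cV[R]_d :=
  \sum_p (sgn (s p) * (B / M%:R)) *: U p.1.
have linV x s : sign_lin (y x) s = dotv (V s) x.
  by rewrite /V dotv_suml; apply: eq_bigr => p _; rewrite dotvZl mulrA.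
have iF s s' s'' : intg nu (fun x => perturbed l (y x) s s' s'').
  apply: (@eq_intg _ _ _ _ (fun x : borel_cV R d =>
     (l ^+ 2 / 2 - l) + (l - l ^+ 2) * (dotv (V s') x * dotv (V s'') x)
     + l ^+ 2 / 2 * (dotv (V s') x * dotv (V s'') x * (dotv (V s') x * dotv (V s'') x))
     + (3 / 2 * l ^+ 2 / beta * (sqcoord x * dotv (V s) x ^+ 2)
       + 3 * l ^+ 2 / beta ^+ 2 * (sqcoord x ^+ 2)))).
    by move=> x; rewrite /perturbed /proxy !linV sqy; field; rewrite gt_eqF.
  apply: intgD; last by apply: intgD; apply: intgZ; [exact: intg_sqcoord_dotv2|exact: intg_sqcoord2].
  apply: intgD; last by apply: intgZ; exact: intg_dotv4.
  by apply: intgD; [exact: intg_cst|apply: intgZ; exact: intg_dotv2].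
have F2 s s' s'' x := perturbed_ge_half l (y x) s s' s''.
have [E [mE PE HE]] := pac_bayes e0 mX indep F2 iF.
exists E; split => // w Ew th s sE s0 sM.
pose m (p : 'I_r * 'I_M) : R := th p.1 / B.
have thB j : th j ^+ 2 < B ^+ 2.
  apply: (@le_lt_trans _ _ s).
    by rewrite sE (bigD1 j)//= lerDl; apply: sumr_ge0 => i _; exact: sqr_ge0.
  by rewrite B2 ltr_pdivlMr// mulrC.
have hm : signed_means m.
  move=> p; rewrite /m normrM normfV (gtr0_norm B0) ltr_pdivrMr// mul1r.
  by rewrite -(@ltr_pXn2r _ 2) ?nnegrE ?normr_ge0 ?ltW// real_normK ?num_real.
have aE x : dotv (comb th) x = \sum_p m p * y x p.
  rewrite /m /y (sumM (fun j => th j / B * (B / M%:R * dotv (U j) x))) dotv_comb.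
  rewrite mulr_sumr; apply: eq_bigr => j _; field; rewrite !gt_eqF//.
have m2 : \sum_p m p ^+ 2 = beta * s.
  rewrite /m (sumM (fun j => (th j / B) ^+ 2)) sE mulr_sumr mulr_sumr.
  apply: eq_bigr => j _; rewrite exprMn exprVn B2; field; rewrite !gt_eqF//.
have := HE w Ew m hm; rewrite m2.
have h1 : \sum_i psi (l * (dotv (comb th) (Xs i w) ^+ 2 - 1)) <=
  sign_exp3 m (fun s s' s'' => \sum_i ln (1 + perturbed l (y (Xs i w)) s s' s'')).
  rewrite /sign_exp3.
  have -> : sign_exp m (fun s => sign_exp m (fun s' => sign_exp m (fun s'' =>
       \sum_i ln (1 + perturbed l (y (Xs i w)) s s' s'')))) =
     \sum_i sign_exp3 m (fun s s' s'' => ln (1 + perturbed l (y (Xs i w)) s s' s'')).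
    rewrite /sign_exp3 -sign_exp_sum; apply: eq_sign_exp => t.
    rewrite -sign_exp_sum; apply: eq_sign_exp => t'.
    by rewrite -sign_exp_sum.
  by apply: ler_sum => i _; exact: psi_le_perturbed.
move=> h2; apply: le_trans h1 (le_trans h2 _); rewrite lerD2l; apply: ler_wpM2l => //.
have -> : sign_exp3 m (fun s s' s'' => \int[nu]_x perturbed l (y x) s s' s'') =
   \int[nu]_x sign_exp3 m (perturbed l (y x)).
  have sw3 t t' := mean_sign_exp m (iF t t').
  have sw2 t := mean_sign_exp m (fun t' => intg_sign_exp m (iF t t')).
  have sw1 := mean_sign_exp m (fun t => intg_sign_exp m (fun t' => intg_sign_exp m (iF t t'))).
  rewrite /sign_exp3 sw1; apply: eq_sign_exp => t; rewrite sw2.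
  by apply: eq_sign_exp => t'; rewrite sw3.
have sg : law_gram (comb th) (comb th) = s by rewrite law_gram_comb sE.
pose a x := dotv (comb th) x.
have ia2 : intg nu (fun x : borel_cV R d => a x ^+ 2) by exact: eq_intg (intg_dotv2 _ _).
have ia4 : intg nu (fun x : borel_cV R d => a x ^+ 4) by exact: int4.
have iq : intg nu (fun x : borel_cV R d => sqcoord x * a x ^+ 2) by exact: intg_sqcoord_dotv2.
have [c0 c0E] : exists c0, c0 = l ^+ 2 / 2 - l by eexists.
apply: (@le_trans _ _ (\int[nu]_x (c0 + (l - l ^+ 2) * a x ^+ 2
   + l ^+ 2 / 2 * a x ^+ 4 + (5 / 2 * l ^+ 2 / beta * (sqcoord x * a x ^+ 2)
   + 5 * l ^+ 2 / beta ^+ 2 * sqcoord x ^+ 2)))).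
  apply: ler_mean.
  - exact: (intg_sign_exp m (fun t => intg_sign_exp m (fun t' => intg_sign_exp m (iF t t')))).
  - apply: intgD; last by apply: intgD; apply: intgZ => //; exact: intg_sqcoord2.
    apply: intgD; last by apply: intgZ.
    by apply: intgD; [exact: intg_cst|apply: intgZ].
  - move=> x; apply: le_trans (perturbed_mean l hm (aE x)) _; rewrite sqy.
    by rewrite le_eqVlt; apply/orP; left; apply/eqP; rewrite /a c0E; field; rewrite gt_eqF.
rewrite meanD; first last.
- by apply: intgD; apply: intgZ => //; exact: intg_sqcoord2.
- apply: intgD; last by apply: intgZ.
  by apply: intgD; [exact: intg_cst|apply: intgZ].
rewrite meanD; first last.
- by apply: intgZ.
- by apply: intgD; [exact: intg_cst|apply: intgZ].
rewrite meanD; first last.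
- exact: intgZ.
- exact: intg_cst.
rewrite meanD; first last.
- by apply: intgZ; exact: intg_sqcoord2.
- exact: intgZ.
rewrite mean_cst !meanZ//; last exact: intg_sqcoord2.
have e2 : \int[nu]_x (a x ^+ 2) = s by [].
rewrite e2.
have e4 : \int[nu]_x (a x ^+ 4) <= kappa * s ^+ 2 by apply: kurtosis; rewrite ?sg.
have eq2 : \int[nu]_x (sqcoord x * a x ^+ 2) <= kappa * (r%:R * s).
  by apply: mean_sqcoord_dotv2; rewrite ?sg.
have eqq := mean_sqcoord2.
have c1 : 0 <= l ^+ 2 / 2 by rewrite divr_ge0 ?sqr_ge0.
have c2 : 0 <= 5 / 2 * l ^+ 2 / beta.
  by apply: divr_ge0; [apply: mulr_ge0 (sqr_ge0 _)|exact: ltW].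
have c3 : 0 <= 5 * l ^+ 2 / beta ^+ 2.
  by apply: divr_ge0 (sqr_ge0 _); apply: mulr_ge0 (sqr_ge0 _).
apply: le_trans (lerD (lerD (lexx _) (ler_wpM2l c1 e4)) (lerD (ler_wpM2l c2 eq2) (ler_wpM2l c3 eqq))) _.
by rewrite le_eqVlt; apply/orP; left; apply/eqP; rewrite c0E; field; rewrite gt_eqF.
Qed.

End family.

End deviations.

(** * Positive semidefinite forms *)

Section bilinear.
Context {R : realType} {d : nat}.
Implicit Types (u v w : 'cV[R]_d) (G H : 'M[R]_d).

Definition bil G u v : R := (u^T *m G *m v) 0 0.

Lemma quadfE G u : quadf G u = bil G u u. Proof. by []. Qed.

Lemma bil1 u v : bil 1%:M u v = dotv u v.
Proof. by rewrite /bil mulmx1. Qed.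

Lemma bilE G u v : bil G u v = \sum_i \sum_j G i j * (u i 0 * v j 0).
Proof.
rewrite /bil mxE exchange_big; apply: eq_bigr => j _.
by rewrite mxE mulr_suml; apply: eq_bigr => i _; rewrite mxE; ring.
Qed.

Lemma bilDl G u v w : bil G (u + v) w = bil G u w + bil G v w.
Proof. by rewrite /bil linearD !mulmxDl mxE. Qed.

Lemma bilZl G (c : R) u w : bil G (c *: u) w = c * bil G u w.
Proof. by rewrite /bil linearZ /= -!scalemxAl mxE. Qed.

Lemma bilDr G u v w : bil G w (u + v) = bil G w u + bil G w v.
Proof. by rewrite /bil mulmxDr mxE. Qed.

Lemma bilZr G (c : R) u w : bil G w (c *: u) = c * bil G w u.
Proof. by rewrite /bil -scalemxAr mxE. Qed.

Lemma bilNr G u w : bil G w (- u) = - bil G w u.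
Proof. by rewrite -scaleN1r bilZr mulN1r. Qed.

Lemma bilNl G u w : bil G (- u) w = - bil G u w.
Proof. by rewrite -scaleN1r bilZl mulN1r. Qed.

Lemma bil_sumr G (I : Type) (s : seq I) (Q : pred I) (F : I -> 'cV[R]_d) w :
  bil G w (\sum_(i <- s | Q i) F i) = \sum_(i <- s | Q i) bil G w (F i).
Proof.
elim/big_rec2 : _ => [|i a b _ <-]; last by rewrite bilDr.
by rewrite /bil mulmx0 mxE.
Qed.

Lemma bil_suml G (I : Type) (s : seq I) (Q : pred I) (F : I -> 'cV[R]_d) w :
  bil G (\sum_(i <- s | Q i) F i) w = \sum_(i <- s | Q i) bil G (F i) w.
Proof.
elim/big_rec2 : _ => [|i a b _ <-]; last by rewrite bilDl.
by rewrite /bil trmx0 !mul0mx mxE.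
Qed.

Lemma bilC G u v : G^T = G -> bil G u v = bil G v u.
Proof.
move=> sG; have -> : bil G u v = ((u^T *m G *m v)^T) 0 0 by rewrite mxE.
by rewrite !trmx_mul trmxK sG mulmxA.
Qed.

Lemma bil_mulr G u v : bil G u v = dotv u (G *m v).
Proof. by rewrite /bil /dotv mulmxA. Qed.

Definition psd G : Prop := G^T = G /\ forall u, 0 <= quadf G u.

Lemma psd1 : psd 1%:M.
Proof.
split=> [|u]; first exact: trmx1.
by rewrite quadfE bil1; exact: dotv_ge0.
Qed.

Lemma psd_bil_sqr G u v : psd G -> bil G u v ^+ 2 <= quadf G u * quadf G v.
Proof.
move=> [sG G0].
have P (t : R) : 0 <= quadf G u + 2 * t * bil G u v + t ^+ 2 * quadf G v.
  have := G0 (u + t *: v); rewrite !quadfE !(bilDl, bilDr, bilZl, bilZr).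
  by rewrite (bilC v u sG); lra.
have a0 := G0 u; have c0 := G0 v.
move: (quadf G u) (quadf G v) (bil G u v) P a0 c0 => a c b P a0 c0.
have [c1|] := ltP 0 c.
  have := P (- b / c).
  rewrite [leRHS](_ : _ = (a * c - b ^+ 2) / c); last by field; rewrite gt_eqF.
  by rewrite pmulr_lge0 ?invr_gt0// subr_ge0.
move=> c1; have c2 : c = 0 by lra.
subst c; rewrite mulr0; have [->|b0] := eqVneq b 0; first by rewrite expr0n.
have := P (- (a + 1) / (2 * b)).
by rewrite [leRHS](_ : _ = -1); [lra|field].
Qed.

Lemma psd_bil0 G u v : psd G -> quadf G u = 0 -> bil G u v = 0.
Proof.
move=> pG u0; have := psd_bil_sqr u v pG; rewrite u0 mul0r => h.
by apply/eqP; rewrite -sqrf_eq0 eq_le h sqr_ge0.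
Qed.

Lemma dotv_eq0 u : dotv u u = 0 -> u = 0.
Proof.
rewrite dotvE => /eqP; rewrite psumr_eq0 => [/allP h|i _]; last exact: sqr_ge0.
apply/colP => i; rewrite mxE; apply/eqP.
by have := h i (mem_index_enum i); rewrite mulf_eq0 orbb.
Qed.

(** A residue that is not isotropic could be normalized and added to the
    family, so a family of maximal size leaves only isotropic residues.  This
    covers both the Euclidean product and a degenerate Gram matrix. *)
Lemma orthonormal_family G (V : {vspace 'cV[R]_d}) : psd G ->
  exists (r : nat) (U : 'I_r -> 'cV[R]_d),
    [/\ (r <= d)%N, forall i, U i \in V,
        forall i j, bil G (U i) (U j) = (i == j)%:R &
        forall v, v \in V -> quadf G (v - \sum_j bil G v (U j) *: U j) = 0].
Proof.
move=> pG; have [sG G0] := pG.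
pose ok r (U : nat -> 'cV[R]_d) := (forall i, (i < r)%N -> U i \in V) /\
  forall i j, (i < r)%N -> (j < r)%N -> bil G (U i) (U j) = (i == j)%:R.
have free r U : ok r U -> (r <= d)%N.
  move=> [UV orU]; pose X := [tuple U i | i < r].
  suff fX : free X.
    have := dimvS (subvf <<X>>%VS); rewrite dimvf /dim /= muln1.
    by move: fX; rewrite /free size_tuple => /eqP ->.
  apply/freeP => k k0 i.
  have := congr1 (fun x => bil G x (U i)) k0.
  rewrite /= bil_suml (bigD1 i)//= [X in _ + X]big1 ?addr0 => [|j ji].
    rewrite (nth_map i) ?size_enum_ord// nth_ord_enum bilZl orU// eqxx mulr1 => ->.
    by rewrite /bil trmx0 !mul0mx mxE.
  rewrite (nth_map i) ?size_enum_ord// nth_ord_enum bilZl orU// (_ : _ == _ = false) ?mulr0//.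
  by rewrite -val_eqE in ji; exact: negbTE.
suff [r [U [okU hU]]] : exists r U, ok r U /\
    forall v, v \in V -> quadf G (v - \sum_(j < r) bil G v (U j) *: U j) = 0.
  exists r, (fun i => U i); have [UV orU] := okU; split => //.
  - exact: free okU.
  - by move=> i; apply: UV.
  - by move=> i j; rewrite orU.
have extend r U : ok r U -> (forall v, v \in V ->
    quadf G (v - \sum_(j < r) bil G v (U j) *: U j) = 0) \/ exists U', ok r.+1 U'.
  move=> [UV orU].
  have [h|] := pselect (forall v, v \in V ->
      quadf G (v - \sum_(j < r) bil G v (U j) *: U j) = 0); first by left.
  move=> /existsNP[v /not_implyP[vV v0]]; right.
  set w := v - _ in v0.
  have wV : w \in V.
    by apply: rpredB => //; apply: rpred_sum => j _; apply: rpredZ; exact: UV.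
  have wU i : (i < r)%N -> bil G w (U i) = 0.
    move=> ir; rewrite /w bilDl bilNl bil_suml (bigD1 (Ordinal ir))//=.
    rewrite big1 ?addr0 => [|j ji]; first by rewrite bilZl orU// eqxx mulr1 subrr.
    by rewrite bilZl orU// (_ : _ == _ = false) ?mulr0//; rewrite -val_eqE in ji; exact: negbTE.
  have w0 : 0 < quadf G w by rewrite lt_def G0 andbT; exact/eqP.
  pose c := (Num.sqrt (quadf G w))^-1.
  have cE : c * (c * quadf G w) = 1.
    rewrite /c -{3}(sqr_sqrtr (ltW w0)); field.
    by rewrite gt_eqF// sqrtr_gt0.
  exists (fun i => if i == r then c *: w else U i); split=> [i|i j].
    rewrite ltnS leq_eqVlt; case: eqP => [_ _|_ /= ir]; first exact: rpredZ.
    exact: UV.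
  rewrite !ltnS (leq_eqVlt i) (leq_eqVlt j).
  case: (eqVneq i r) => [->|ir]; case: (eqVneq j r) => [->|jr] //= h1 h2.
  - by rewrite bilZl bilZr -quadfE cE.
  - by rewrite bilZl wU// mulr0.
  - by rewrite bilZr (bilC _ _ sG) wU// mulr0 (negbTE ir).
  - exact: orU.
suff loop k r U : ok r U -> (d - r <= k)%N -> exists r U, ok r U /\
    forall v, v \in V -> quadf G (v - \sum_(j < r) bil G v (U j) *: U j) = 0.
  by apply: (loop d 0 (fun=> 0)); rewrite ?subn0//; split.
elim: k r U => [|k IH] r U okU dk.
  have [h|[U' okU']] := extend r U okU; first by exists r, U.
  by have := free _ _ okU'; rewrite ltnNge -subn_eq0 -leqn0 dk.
have [h|[U' okU']] := extend r U okU; first by exists r, U.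
by apply: (IH r.+1 U') => //; rewrite subnS; case: (d - r)%N dk.
Qed.

Lemma sum_mul_sqr_le (I : finType) (a b : I -> R) :
  (\sum_i a i * b i) ^+ 2 <= (\sum_i a i ^+ 2) * (\sum_i b i ^+ 2).
Proof.
have : 0 <= \sum_i \sum_j (a i * b j - a j * b i) ^+ 2.
  by apply: sumr_ge0 => i _; apply: sumr_ge0 => j _; exact: sqr_ge0.
rewrite (_ : \sum_i \sum_j _ =
  2 * ((\sum_i a i ^+ 2) * (\sum_i b i ^+ 2) - (\sum_i a i * b i) ^+ 2)).
  by rewrite pmulr_rge0// subr_ge0.
have E (x y : I -> R) : (\sum_i x i) * (\sum_i y i) = \sum_i \sum_j x i * y j.
  by rewrite mulr_suml; apply: eq_bigr => i _; rewrite mulr_sumr.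
rewrite mulrBr mulr_natl mulr2n {2}[_ * (\sum_i b i ^+ 2)]mulrC expr2 !E mulr_sumr.
rewrite -big_split /= -sumrB; apply: eq_bigr => i _.
by rewrite mulr_sumr -big_split /= -sumrB; apply: eq_bigr => j _; ring.
Qed.

Lemma frobeniusE H : H^T = H -> \tr (H *m H) = \sum_i \sum_j H i j ^+ 2.
Proof.
move=> sH; rewrite /mxtrace; apply: eq_bigr => i _; rewrite mxE.
by apply: eq_bigr => j _; rewrite -{2}sH mxE expr2.
Qed.

Lemma bil_sqr_le_frobenius H u v : H^T = H ->
  bil H u v ^+ 2 <= \tr (H *m H) * (dotv u u * dotv v v).
Proof.
move=> sH; rewrite bilE pair_big/= (frobeniusE sH) pair_big/=.
apply: le_trans (sum_mul_sqr_le (fun p => H p.1 p.2) (fun p => u p.1 0 * v p.2 0)) _.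
rewrite [X in _ * X <= _](_ : _ = dotv u u * dotv v v)//.
rewrite !dotvE mulr_suml -(pair_bigA _ (fun i j => (u i 0 * v j 0) ^+ 2)) /=.
by apply: eq_bigr => i _; rewrite mulr_sumr; apply: eq_bigr => j _; ring.
Qed.

(** In the basis [e] the entries of the matrix are the values
    [bil G (e i) (e j)], to which Cauchy-Schwarz applies. *)
Lemma psd_frobenius_le G (e : 'I_d -> 'cV[R]_d) : psd G -> orthonormal_basis e ->
  \tr (G *m G) <= (\sum_i quadf G (e i)) ^+ 2.
Proof.
move=> pG oe; have [sG G0] := pG.
pose O : 'M[R]_d := \matrix_(i, j) e j i 0.
have OO : O^T *m O = 1%:M.
  apply/matrixP => i j; rewrite mxE [RHS]mxE -oe dotvE.
  by apply: eq_bigr => k _; rewrite !mxE.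
have OO' : O *m O^T = 1%:M by exact: mulmx1C.
pose A := O^T *m G *m O.
have AE i j : A i j = bil G (e i) (e j).
  rewrite /A /bil !mxE; apply: eq_bigr => l _; rewrite !mxE; congr (_ * _).
  by apply: eq_bigr => k _; rewrite !mxE.
have sA : A^T = A by rewrite /A !trmx_mul trmxK sG mulmxA.
have -> : \tr (G *m G) = \tr (A *m A).
  rewrite /A -!mulmxA [\tr (O^T *m _)]mxtrace_mulC !mulmxA.
  by rewrite -[_ *m O *m O^T]mulmxA OO' mulmx1 -[_ *m O *m O^T]mulmxA OO' mulmx1.
rewrite (frobeniusE sA) expr2 mulr_suml; apply: ler_sum => i _.
rewrite mulr_sumr; apply: ler_sum => j _; rewrite AE; exact: psd_bil_sqr.
Qed.

End bilinear.

(** * Compactness: nets and minimizers *)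

Section topology.
Context {R : realType}.

Section continuity.
Context {n : nat}.
Implicit Types f g : 'rV[R]_n -> R.

Lemma continuous_add f g : continuous f -> continuous g ->
  continuous (fun v => f v + g v).
Proof. by move=> cf cg v; exact: cvgD (cf v) (cg v). Qed.

Lemma continuous_mul f g : continuous f -> continuous g ->
  continuous (fun v => f v * g v).
Proof. by move=> cf cg v; exact: cvgM (cf v) (cg v). Qed.

Lemma continuous_const (c : R) : continuous (fun _ : 'rV[R]_n => c).
Proof. exact: cst_continuous. Qed.

Lemma continuous_big_sum (I : Type) (s : seq I) (F : I -> 'rV[R]_n -> R) :
  (forall i, continuous (F i)) -> continuous (fun v => \sum_(i <- s) F i v).
Proof.
move=> cF; elim: s => [|i s IH].
  by under eq_fun do rewrite big_nil; exact: continuous_const.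
by under eq_fun do rewrite big_cons; exact: continuous_add.
Qed.

Lemma closed_eq_level f (c : R) : continuous f -> closed [set v | f v = c].
Proof. by move=> cf; apply: (@closed_comp _ _ f [set y | y = c]) => [v _|]; [exact: cf|exact: closed_eq]. Qed.

Lemma closed_le_level f (c : R) : continuous f -> closed [set v | f v <= c].
Proof. by move=> cf; apply: (@closed_comp _ _ f [set y | y <= c]) => [v _|]; [exact: cf|exact: closed_le]. Qed.

Lemma closed_ge_level f (c : R) : continuous f -> closed [set v | c <= f v].
Proof. by move=> cf; apply: (@closed_comp _ _ f [set y | c <= y]) => [v _|]; [exact: cf|exact: closed_ge]. Qed.

Lemma compact_rV (A : set 'rV[R]_n) (M : R) : 0 <= M -> closed A ->
  (forall v, A v -> forall i, `|v 0 i| <= M) -> compact A.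
Proof.
move=> M0 cA bA; apply: bounded_closed_compact => //.
exists M; split=> [|r Mr v Av]; first exact: num_real.
rewrite /= [leLHS]/Num.Def.normr /= mx_normrE; apply/bigmax_leP; split=> [|[i j] _ /=].
  exact: le_trans M0 (ltW Mr).
by rewrite (ord1 i) (le_trans (bA v Av j))// ltW.
Qed.

End continuity.

Section sphere.
Context {d : nat}.

Lemma continuous_tr_coord i : continuous (fun v : 'rV[R]_d => v^T i 0).
Proof. by under eq_fun do rewrite mxE; exact: coord_continuous. Qed.

Lemma continuous_quadf (G : 'M[R]_d) : continuous (fun v : 'rV[R]_d => quadf G v^T).
Proof.
under eq_fun do rewrite quadfE bilE; apply: continuous_big_sum => i.
apply: continuous_big_sum => j; apply: continuous_mul; first exact: continuous_const.
by apply: continuous_mul; exact: continuous_tr_coord.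
Qed.

Lemma orthogonal_projection (V : {vspace 'cV[R]_d}) :
  exists Q : 'M[R]_d, [/\ forall u, Q *m u \in V, forall v, v \in V -> Q *m v = v &
    forall u v, v \in V -> dotv (u - Q *m u) v = 0].
Proof.
have [r [U [_ UV orU hU]]] := orthonormal_family V (@psd1 R d).
pose Q : 'M[R]_d := \sum_j U j *m (U j)^T.
have QE u : Q *m u = \sum_j dotv (U j) u *: U j.
  rewrite /Q mulmx_suml; apply: eq_bigr => j _.
  by rewrite -mulmxA [(U j)^T *m u]mx11_scalar mul_mx_scalar.
have QV v : v \in V -> Q *m v = v.
  move=> vV; have := hU v vV; rewrite quadfE bil1 => /dotv_eq0/eqP.
  rewrite subr_eq0 => /eqP {2}->; rewrite QE; apply: eq_bigr => j _.
  by rewrite bil1 dotvC.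
exists Q; split => // [u|u v vV].
  by rewrite QE; apply: rpred_sum => j _; apply: rpredZ.
have key j : dotv (u - Q *m u) (U j) = 0.
  rewrite dotvDl -scaleN1r dotvZl QE dotv_suml (bigD1 j)//= big1 => [|i ij].
    by rewrite dotvZl -[dotv (U j) (U j)]bil1 orU eqxx mulr1 addr0 dotvC mulN1r subrr.
  by rewrite dotvZl -[dotv (U i) (U j)]bil1 orU (negbTE ij) mulr0.
rewrite -(QV v vV) (QE v) -bil1 bil_sumr big1// => j _.
by rewrite bilZr bil1 key mulr0.
Qed.

(** Membership is the linear equation [Q *m u = u] for a projection [Q]. *)
Lemma closed_mem_vspace (m : nat) (V : {vspace 'cV[R]_d}) (F : 'rV[R]_m -> 'cV[R]_d) :
  (forall i, continuous (fun v => F v i 0)) -> closed [set v | F v \in V].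
Proof.
move=> cF; have [Q [QV Qid _]] := orthogonal_projection V.
rewrite (_ : [set v | _] = \bigcap_(i in [set: 'I_d]) [set v | (Q *m F v) i 0 + (-1) * F v i 0 = 0]).
  apply: closed_bigI => i _; apply: closed_eq_level; apply: continuous_add.
    under eq_fun do rewrite mxE; apply: continuous_big_sum => j.
    by apply: continuous_mul; [exact: continuous_const|exact: cF].
  by apply: continuous_mul; [exact: continuous_const|exact: cF].
apply/seteqP; split=> v /= h => [i _ /=|]; first by rewrite Qid// mulN1r subrr.
suff <- : Q *m F v = F v by exact: QV.
by apply/colP => i; have := h i I => /eqP; rewrite /= mulN1r subr_eq0 => /eqP.
Qed.

Lemma enorm_eq1 (u : 'cV[R]_d) : (enorm u = 1) <-> (dotv u u = 1).
Proof.
have u0 := dotv_ge0 u.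
split=> [h|h]; last by rewrite /enorm h sqrtr1.
by rewrite -(sqr_sqrtr u0) -/(enorm u) h expr1n.
Qed.

Lemma compact_data_sphere n (x : 'I_n -> 'cV[R]_d) :
  compact [set v : 'rV[R]_d | data_sphere x v^T].
Proof.
apply: (compact_rV ler01).
  apply: closedI; first exact: closed_mem_vspace continuous_tr_coord.
  rewrite (_ : (fun _ => _) = [set v : 'rV[R]_d | quadf 1%:M v^T = 1]).
    by apply: closed_eq_level; exact: continuous_quadf.
  by apply/seteqP; split=> v /=; rewrite quadfE bil1 enorm_eq1.
move=> v [_ /enorm_eq1 h] i; rewrite -sqrtr_sqr -sqrtr1; apply: ler_wsqrtr.
rewrite -h dotvE (bigD1 i)//= !mxE -expr2 lerDl.
by apply: sumr_ge0 => j _; exact: sqr_ge0.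
Qed.

Lemma sphere_net_exists n (x : 'I_n -> 'cV[R]_d) (rho : R) : 0 < rho ->
  exists Theta, sphere_net x rho Theta.
Proof.
move=> rho0; pose K := [set v : 'rV[R]_d | data_sphere x v^T].
have : compact K by exact: compact_data_sphere.
rewrite compact_cover => cK.
pose f (p : 'rV[R]_d) := [set v : 'rV[R]_d | quadf 1%:M (v - p)^T < rho ^+ 2].
have [] := cK _ K f.
- move=> p _; rewrite /f.
  have cf : continuous (fun v : 'rV[R]_d => quadf 1%:M (v - p)^T).
    under eq_fun do rewrite quadfE bilE; apply: continuous_big_sum => i.
    have cc k : continuous (fun v : 'rV[R]_d => (v - p)^T k 0).
      under eq_fun do rewrite !mxE; apply: continuous_add; first exact: coord_continuous.
      exact: continuous_const.
    apply: continuous_big_sum => j; apply: continuous_mul; first exact: continuous_const.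
    by apply: continuous_mul; exact: cc.
  by apply: (@open_comp _ _ _ [set y : R | y < rho ^+ 2]) => [v _|]; [exact: cf|exact: open_lt].
- move=> v Kv; exists v => //=.
  by rewrite /f /= subrr quadfE /bil !trmx0 mulmx0 mxE exprn_gt0.
move=> D DK cov.
exists [set u | exists2 p : 'rV[R]_d, [set` D] p & u = p^T]; split.
- rewrite (_ : [set u | _] = trmx @` [set` D]); first exact/finite_image/finite_fset.
  by apply/seteqP; split=> [u [p pD ->]|u [p pD <-]]; [exists p|exists p].
- by move=> u [p pD ->]; have := DK p pD => /set_mem.
- move=> u Ku; have [|p pD] := cov u^T; first by rewrite /K /= trmxK.
  rewrite /f /= => h; exists p^T; first by exists p.
  move: h; rewrite linearB /= trmxK quadfE bil1 => h.
  rewrite /enorm -[leRHS](ger0_norm (ltW rho0)) -sqrtr_sqr; apply: ler_wsqrtr; exact: ltW.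
Qed.

(** Below the Frobenius norm of one feasible matrix the feasible set is
    compact.  Matrices are handled as row vectors through [mxvec]. *)
Lemma feasible_minimizer n (x : 'I_n -> 'cV[R]_d) (lambda delta : R) (Theta : set 'cV[R]_d) G :
  feasible lambda delta x Theta G ->
  exists2 H, feasible lambda delta x Theta H & forall H', feasible lambda delta x Theta H' ->
    \tr (H *m H) <= \tr (H' *m H').
Proof.
move=> fG.
pose Fr (h : 'rV[R]_(d * d)) := \sum_i \sum_j vec_mx h i j ^+ 2.
pose K := [set h : 'rV[R]_(d * d) | feasible lambda delta x Theta (vec_mx h)].
pose c := \tr (G *m G).
have FrE H : feasible lambda delta x Theta H -> \tr (H *m H) = Fr (mxvec H).
  by case=> sH _ _; rewrite frobeniusE// /Fr mxvecK.
have cc i j : continuous (fun h : 'rV[R]_(d * d) => vec_mx h i j).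
  by under eq_fun do rewrite mxE; exact: coord_continuous.
have cFr : continuous Fr.
  apply: continuous_big_sum => i; apply: continuous_big_sum => j.
  by under eq_fun do rewrite expr2; exact: continuous_mul.
have clK : closed K.
  rewrite (_ : K = (\bigcap_(p in [set: 'I_d * 'I_d])
       [set h | vec_mx h p.1 p.2 + (-1) * vec_mx h p.2 p.1 = 0]) `&`
     ((\bigcap_(u in [set: 'cV[R]_d]) [set h | vec_mx h *m u \in data_span x]) `&`
     (\bigcap_(t in Theta) ([set h | (1 - delta) * Nhat lambda x t <= quadf (vec_mx h) t] `&`
        [set h | quadf (vec_mx h) t <= (1 + delta) * Nhat lambda x t])))).
    apply: closedI; last apply: closedI.
    - apply: closed_bigI => p _; apply: closed_eq_level; apply: continuous_add => //.
      by apply: continuous_mul => //; exact: continuous_const.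
    - apply: closed_bigI => u _; apply: closed_mem_vspace => i.
      under eq_fun do rewrite mxE; apply: continuous_big_sum => j.
      by apply: continuous_mul => //; exact: continuous_const.
    - apply: closed_bigI => t _.
      have cq : continuous (fun h : 'rV[R]_(d * d) => quadf (vec_mx h) t).
        under eq_fun do rewrite quadfE bilE; do 2! (apply: continuous_big_sum => ?).
        by apply: continuous_mul => //; exact: continuous_const.
      by apply: closedI; [exact: closed_ge_level|exact: closed_le_level].
  apply/seteqP; split=> h /=.
    move=> [sH VH tH]; split; last split.
    - by move=> p _ /=; rewrite -{1}sH mxE mulN1r subrr.
    - by move=> u _; exact: VH.
    - by move=> t Tt; have /andP[] := tH t Tt.
  move=> [sH [VH tH]]; split.
  - by apply/matrixP => i j; rewrite mxE; have := sH (j, i) I => /eqP;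
      rewrite /= mulN1r subr_eq0 => /eqP.
  - by move=> u; exact: VH.
  - by move=> t Tt; have [h1 h2] := tH t Tt; apply/andP.
pose A := K `&` [set h | Fr h <= c].
have c0 : 0 <= c.
  rewrite /c FrE// /Fr; do 2! (apply: sumr_ge0 => ? _); exact: sqr_ge0.
have cA : compact A.
  apply: (@compact_rV _ _ (Num.sqrt c)); first exact: sqrtr_ge0.
    by apply: closedI => //; exact: closed_le_level.
  move=> h [_ /= hc] k; rewrite -sqrtr_sqr; apply: ler_wsqrtr; apply: le_trans _ hc.
  case: (mxvec_indexP k) => i j; rewrite /Fr (bigD1 i)//= (bigD1 j)//= -addrA mxE lerDl.
  by rewrite addr_ge0//; do ! (apply: sumr_ge0 => ? _); exact: sqr_ge0.
have AG : A (mxvec G) by split; rewrite /K /= ?mxvecK// -FrE.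
have [h /set_mem[Kh hc] hmin] := EVT_min_rV (ex_intro _ _ AG) cA (continuous_subspaceT cFr).
exists (vec_mx h) => // H' fH'; rewrite !FrE// vec_mxK.
have [h1|h1] := leP (Fr (mxvec H')) c; last by apply: le_trans hc (ltW h1).
by apply: hmin; apply: mem_set; split; rewrite /K /= ?mxvecK.
Qed.

End sphere.
End topology.

(** * From directional estimates to a matrix *)

Section deterministic.
Context {R : realType} {d n : nat}.
Implicit Types (x : 'I_n -> 'cV[R]_d) (u v : 'cV[R]_d).

Lemma Nhat_ge0 (lambda : R) x u : 0 <= Nhat lambda x u.
Proof.
rewrite /Nhat; set A := [set rho | _].
have [->|/set0P A0] := eqVneq A set0; first by rewrite inf0.
by apply: lb_le_inf => // rho [/ltW].
Qed.

Lemma Nhat_le (lambda : R) x u rho : 0 < rho ->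
  \sum_(i < n) psi (lambda * (rho^-1 * dotv u (x i) ^+ 2 - 1)) <= 0 ->
  Nhat lambda x u <= rho.
Proof.
by move=> r0 h; apply: ge_inf => //; exists 0 => r [/ltW].
Qed.

Lemma Nhat_eq0 (lambda : R) x u : 0 <= lambda -> (forall i, dotv u (x i) = 0) ->
  Nhat lambda x u = 0.
Proof.
move=> l0 h; apply/eqP; rewrite eq_le Nhat_ge0 andbT.
apply/ler_addgt0Pr => r r0; rewrite add0r; apply: Nhat_le => //.
apply: sumr_le0 => i _; rewrite h expr0n /= mulr0 sub0r mulrN1 psiN oppr_le0.
exact: psi_ge0.
Qed.

Lemma data_span_orthogonal x u v : (forall i, dotv u (x i) = 0) ->
  v \in data_span x -> dotv u v = 0.
Proof.
move=> h; rewrite /data_span => vV.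
have vE := coord_span (X := in_tuple (codom x)) vV.
rewrite vE -bil1 bil_sumr big1// => i _; rewrite bilZr bil1.
have /codomP[j ->] : (codom x)`_i \in codom x by apply: mem_nth.
by rewrite h mulr0.
Qed.

Variables (lambda delta : R) (e : 'I_d -> 'cV[R]_d) (x : 'I_n -> 'cV[R]_d) (G : 'M[R]_d).
Hypotheses (lambda0 : 0 <= lambda) (delta0 : 0 < delta) (delta1 : delta < 1 / 2)
  (ortho_e : orthonormal_basis e) (psdG : psd G).
Hypothesis near_gram : forall u,
  (1 - delta) * Nhat lambda x u <= quadf G u <= (1 + delta) * Nhat lambda x u.
Hypothesis kernel_gram : forall u, quadf G u = 0 -> forall i, dotv u (x i) = 0.

(** Orthogonally to the data the directional estimate is zero, and the upper
    bracket passes this on to the form. *)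
Lemma gram_orthogonal_data u : (forall v, v \in data_span x -> dotv u v = 0) ->
  quadf G u = 0.
Proof.
move=> h; have /andP[_] := near_gram u; rewrite Nhat_eq0// ?mulr0.
  by move=> g0; apply/eqP; rewrite eq_le g0 (proj2 psdG).
by move=> i; apply: h; apply: memv_span; exact: codom_f.
Qed.

Lemma gram_image u : G *m u \in data_span x.
Proof.
have [Q [QV _ Qo]] := orthogonal_projection (data_span x).
suff /eqP : G *m u - Q *m (G *m u) = 0 by rewrite subr_eq0 => /eqP ->.
set w := _ - _; apply: dotv_eq0.
rewrite -[dotv w w]bil1 {2}/w bilDr bilNr !bil1 (Qo _ _ (QV _)) subr0 -bil_mulr.
by apply: psd_bil0 => //; apply: gram_orthogonal_data => v vV; exact: Qo.
Qed.

Lemma gram_feasible (Theta : set 'cV[R]_d) : feasible lambda delta x Theta G.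
Proof.
by split=> [|u|t _]; [exact: (proj1 psdG)|exact: gram_image|exact: near_gram].
Qed.

Lemma gram_sphere_gt0 u : data_sphere x u -> 0 < quadf G u.
Proof.
move=> [uV /enorm_eq1 u1]; rewrite lt_def (proj2 psdG) andbT; apply/eqP => g0.
have := data_span_orthogonal (kernel_gram g0) uV; rewrite u1 => /eqP.
by rewrite oner_eq0.
Qed.

Lemma gram_sphere_bounded_below :
  exists2 c : R, 0 < c & forall u, data_sphere x u -> c <= quadf G u.
Proof.
have [[u Su]|h] := pselect (exists u, data_sphere x u); last first.
  by exists 1 => // u Su; exfalso; apply: h; exists u.
have cK : compact [set v : 'rV[R]_d | data_sphere x v^T] by exact: compact_data_sphere.
have K0 : [set v : 'rV[R]_d | data_sphere x v^T] !=set0.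
  by exists u^T; rewrite /= trmxK.
have [v /set_mem Sv vmin] := EVT_min_rV K0 cK (continuous_subspaceT (continuous_quadf (G := G))).
exists (quadf G v^T); first exact: gram_sphere_gt0.
by move=> w Sw; rewrite -[w]trmxK; apply: vmin; apply: mem_set; rewrite /= trmxK.
Qed.

Let S : R := \sum_(i < d) Nhat lambda x (e i).

Lemma Nhat_basis_ge0 : 0 <= S.
Proof. by apply: sumr_ge0 => i _; exact: Nhat_ge0. Qed.

Lemma gram_frobenius_le : \tr (G *m G) <= ((1 + delta) * S) ^+ 2.
Proof.
have dl0 := delta0; apply: le_trans (psd_frobenius_le psdG ortho_e) _.
rewrite ler_pXn2r ?nnegrE//.
- by rewrite /S mulr_sumr; apply: ler_sum => i _; have /andP[] := near_gram (e i).
- by apply: sumr_ge0 => i _; exact: (proj2 psdG).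
- by apply: mulr_ge0; [lra|exact: Nhat_basis_ge0].
Qed.

(** On the data sphere the form is positive, hence by compactness bounded
    below; through the bracket the infimum of the directional estimate is
    positive too, which leaves room for a positive radius. *)
Lemma is_Ghat_exists : exists H, is_Ghat lambda delta e x H.
Proof.
have dl0 := delta0; have [c c0 hc] := gram_sphere_bounded_below.
have d1 : 0 < 1 + delta by lra.
have c'0 : 0 < c / (1 + delta) by rewrite divr_gt0.
have lm : ((c / (1 + delta))%:E <= lambda_min_hat lambda x)%E.
  apply: le_ereal_inf_tmp => _ [u Su <-]; rewrite lee_fin ler_pdivrMr// mulrC.
  by apply: le_trans (hc u Su) _; have /andP[] := near_gram u.
have d2 : 0 < delta ^+ 2 by rewrite exprn_gt0//; lra.
have X0 : ((delta ^+ 2 * (c / (1 + delta)))%:E <= (delta ^+ 2)%:E * lambda_min_hat lambda x)%E.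
  by rewrite EFinM; apply: lee_wpmul2l lm; rewrite lee_fin ltW.
have [rho rad] : exists rho, admissible_radius lambda delta e x rho.
  have [S0|S0] := eqVneq S 0.
    (* A positive number divided by zero: every radius is admissible. *)
    exists 1; split => //; rewrite -/S S0 mulr0 /ediv.
    have Xp := lt_le_trans (_ : (0 < (delta ^+ 2 * (c / (1 + delta)))%:E)%E) X0.
    by rewrite gt_eqF/= ?inve0 ?gt0_muley ?leey// Xp// lte_fin mulr_gt0.
  have Sp : 0 < S by rewrite lt_def S0 Nhat_basis_ge0.
  exists (delta ^+ 2 * (c / (1 + delta)) / (2 * S)); split.
    by rewrite divr_gt0// mulr_gt0.
  rewrite -/S /ediv (_ : (_ == 0%E) && _ = false); last first.
    by apply/negbTE; rewrite negb_and; apply/orP; right; rewrite eqe mulf_neq0.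
  rewrite inver (negbTE (mulf_neq0 _ _))// EFinM; apply: lee_wpmul2r => //.
  by rewrite lee_fin invr_ge0 mulr_ge0// ltW.
have [N netN] := sphere_net_exists x (proj1 rad).
have [H fH minH] := feasible_minimizer (gram_feasible N).
by exists H, rho, N.
Qed.

(** The Gram matrix competes in the minimization, so both matrices have
    Frobenius norm at most [(1 + delta) * S].  Moving from a point of the
    sphere to the net thus costs at most [(1 + delta) * delta ^+ 2] times the
    directional estimate, by the choice of the radius, while on the net the
    two forms differ by at most [2 * delta] times the estimate there.  Altogether
    the relative error is [2 * delta * (1 + delta ^+ 2) / (1 - delta) ^+ 2]. *)
Lemma is_Ghat_sphere H u : is_Ghat lambda delta e x H -> data_sphere x u ->
  `|quadf H u - quadf G u| <= 2 * delta / (1 - 2 * delta) * quadf G u.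
Proof.
move=> [rho [N [[rho0 rad] [_ TV netN] fH minH]]] Su.
have dl0 := delta0; have dl1 := delta1.
have [sH VH tH] := fH.
have [t Tt ut] := netN u Su.
have St := TV t Tt.
have g0 := gram_sphere_gt0 Su.
have S0 : 0 < S.
  rewrite lt_def Nhat_basis_ge0 andbT; apply/eqP => S0.
  have := bil_sqr_le_frobenius u u (proj1 psdG).
  have := gram_frobenius_le; rewrite S0 mulr0 expr0n /= => tr0.
  have [_ /enorm_eq1 u1] := Su; rewrite u1 -quadfE => h.
  have : 0 < quadf G u ^+ 2 by rewrite exprn_gt0.
  by lra.
set a := Nhat lambda x u.
have rhoS : 2 * (rho * S) <= delta ^+ 2 * a.
  move: rad; rewrite -/S /ediv (_ : (_ == 0%E) && _ = false); last first.
    by apply/negbTE; rewrite negb_and; apply/orP; right; rewrite eqe mulf_neq0// gt_eqF.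
  rewrite inver (negbTE (mulf_neq0 _ _))// ?gt_eqF// => rad.
  have lm : (lambda_min_hat lambda x <= a%:E)%E by apply: ereal_inf_lbound; exists u.
  have : (rho%:E <= (delta ^+ 2 * a / (2 * S))%:E)%E.
    apply: le_trans rad _; rewrite (EFinM (delta ^+ 2 * a)); apply: lee_wpmul2r.
      by rewrite lee_fin invr_ge0 mulr_ge0// ltW.
    by rewrite (EFinM (delta ^+ 2)); apply: lee_wpmul2l => //; rewrite lee_fin sqr_ge0.
  by rewrite lee_fin ler_pdivlMr ?mulr_gt0//; lra.
have [_ /enorm_eq1 u1] := Su; have [_ /enorm_eq1 t1] := St.
have du : dotv (u - t) (u - t) <= rho ^+ 2.
  have p : 0 <= dotv (u - t) (u - t).
    exact: dotv_ge0.
  by rewrite -(sqr_sqrtr p) ler_pXn2r ?nnegrE// ?sqrtr_ge0// ltW.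
have dp : dotv (u + t) (u + t) <= 4.
  have : 0 <= dotv (u - t) (u - t).
    exact: dotv_ge0.
  rewrite -!bil1 !(bilDl, bilDr, bilNl, bilNr) !bil1 u1 t1 (dotvC t u); lra.
have dp0 : 0 <= dotv (u + t) (u + t).
  exact: dotv_ge0.
have close A : A^T = A -> \tr (A *m A) <= ((1 + delta) * S) ^+ 2 ->
    `|quadf A u - quadf A t| <= (1 + delta) * (delta ^+ 2 * a).
  move=> sA trA.
  have -> : quadf A u - quadf A t = bil A (u - t) (u + t).
    by rewrite !quadfE !(bilDl, bilDr, bilNl) (bilC t u sA); ring.
  have F0 : 0 <= (1 + delta) * S by rewrite mulr_ge0 ?ltW//; lra.
  apply: (@le_trans _ _ ((1 + delta) * S * (rho * 2))); last first.
    have : (1 + delta) * (2 * (rho * S)) <= (1 + delta) * (delta ^+ 2 * a).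
      by apply: ler_wpM2l => //; lra.
    by lra.
  have r2 : 0 <= rho * 2 by lra.
  rewrite -(@ler_pXn2r _ 2) ?nnegrE ?normr_ge0 ?(mulr_ge0 F0 r2)//.
  rewrite real_normK ?num_real// exprMn; apply: le_trans (bil_sqr_le_frobenius _ _ sA) _.
  have q0 : 0 <= dotv (u - t) (u - t).
    exact: dotv_ge0.
  apply: ler_pM => //.
  - rewrite frobeniusE//; do 2! (apply: sumr_ge0 => ? _); exact: sqr_ge0.
  - exact: mulr_ge0.
  - by rewrite exprMn; apply: ler_pM => //; rewrite expr2; lra.
have cG := close G (proj1 psdG) gram_frobenius_le.
have cH := close H sH (le_trans (minH G (gram_feasible N)) gram_frobenius_le).
have /andP[h1 h2] := tH t Tt.
have /andP[g1 g2] := near_gram t; have /andP[k1 k2] := near_gram u; rewrite -/a in k1 k2.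
have b0 := Nhat_ge0 lambda x t; have a0 : 0 <= a := Nhat_ge0 lambda x u.
move: (quadf G u) (quadf G t) (quadf H u) (quadf H t) (Nhat lambda x t) b0 h1 h2 g1 g2 k1 k2 cG cH g0.
move: (a) a0 => {rhoS close} a' a'0 g gt h ht b b0 h1 h2 g1 g2 k1 k2 cG cH g0.
have D0 : 0 < 1 - delta by lra.
have D1 : 0 < 1 - 2 * delta by lra.
set E := (1 + delta) * (delta ^+ 2 * a') in cG cH.
have EG : E * (1 - delta) <= (1 + delta) * delta ^+ 2 * g.
  rewrite /E; have -> : (1 + delta) * (delta ^+ 2 * a') * (1 - delta) =
    (1 + delta) * delta ^+ 2 * ((1 - delta) * a') by ring.
  by apply: ler_wpM2l => //; rewrite mulr_ge0 ?sqr_ge0//; lra.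
have hb : `|ht - gt| <= 2 * delta * b by rewrite ler_norml; apply/andP; split; lra.
move: cG cH; rewrite !(ler_norml) => /andP[cG1 cG2] /andP[cH1 cH2].
move: hb; rewrite ler_norml => /andP[hb1 hb2].
have bound : (1 - delta) * (2 * delta * b) <= 2 * delta * (g + E).
  have : 2 * delta * ((1 - delta) * b) <= 2 * delta * (g + E) by apply: ler_wpM2l; lra.
  by lra.
suff K : 2 * E + 2 * delta * b <= 2 * delta / (1 - 2 * delta) * g.
  by apply/andP; split; lra.
rewrite [leRHS]mulrAC ler_pdivlMr//.
rewrite -(ler_pM2r (exprn_gt0 2 D0)).
have E0 : 0 <= E by rewrite /E !mulr_ge0 ?sqr_ge0//; lra.
have s1 : (1 - delta) ^+ 2 * (2 * E + 2 * delta * b) <= 2 * delta * (1 + delta ^+ 2) * g.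
  have i1 : (1 - delta) * ((1 - delta) * (2 * delta * b)) <= (1 - delta) * (2 * delta * (g + E)).
    by apply: ler_wpM2l bound; lra.
  have i2 : 2 * (E * (1 - delta)) <= 2 * ((1 + delta) * delta ^+ 2 * g) by lra.
  have -> : (1 - delta) ^+ 2 * (2 * E + 2 * delta * b) =
    (1 - delta) * (2 * (E * (1 - delta))) + (1 - delta) * ((1 - delta) * (2 * delta * b)) by ring.
  have i3 : (1 - delta) * (2 * (E * (1 - delta))) <= (1 - delta) * (2 * ((1 + delta) * delta ^+ 2 * g)).
    by apply: ler_wpM2l => //; lra.
  have i4 : 2 * delta * (E * (1 - delta)) <= 2 * delta * ((1 + delta) * delta ^+ 2 * g).
    by apply: ler_wpM2l => //; lra.
  apply: le_trans (lerD i3 i1) _.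
  have -> : (1 - delta) * (2 * ((1 + delta) * delta ^+ 2 * g)) + (1 - delta) * (2 * delta * (g + E))
    = 2 * (1 - delta) * ((1 + delta) * delta ^+ 2 * g) + 2 * delta * (1 - delta) * g + 2 * delta * (E * (1 - delta)) by ring.
  have -> : 2 * delta * (1 + delta ^+ 2) * g =  2 * (1 - delta) * ((1 + delta) * delta ^+ 2 * g) + 2 * delta * (1 - delta) * g
     + 2 * delta * ((1 + delta) * delta ^+ 2 * g) by ring.
  by rewrite lerD2l.
have -> : (2 * E + 2 * delta * b) * (1 - 2 * delta) * (1 - delta) ^+ 2 =
  (1 - 2 * delta) * ((1 - delta) ^+ 2 * (2 * E + 2 * delta * b)) by ring.
apply: le_trans (ler_wpM2l (ltW D1) s1) _.
rewrite -subr_ge0 [leRHS](_ : _ = 4 * delta ^+ 4 * g); last by ring.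
apply: mulr_ge0 (ltW g0); apply: mulr_ge0 => //; exact: exprn_ge0 (ltW dl0).
Qed.

(** Both matrices vanish orthogonally to the data span, so that only the
    projection of [u] counts, and homogeneity brings it to the sphere. *)
Lemma is_Ghat_bound H u : is_Ghat lambda delta e x H ->
  (`| ediv (quadf H u)%:E (quadf G u)%:E - 1 | <= (2 * delta / (1 - 2 * delta))%:E)%E.
Proof.
move=> GH; have [rho [N [_ _ [sH VH _] _]]] := GH.
have dl0 := delta0; have dl1 := delta1.
have K0 : 0 <= 2 * delta / (1 - 2 * delta) by rewrite divr_ge0//; lra.
have [Q [QV _ Qo]] := orthogonal_projection (data_span x).
set p := Q *m u; set q := u - p.
have red A : A^T = A -> (forall v, A *m v \in data_span x) -> quadf A u = quadf A p.
  move=> sA VA.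
  have Aq v : bil A q v = 0 by rewrite bil_mulr; exact: Qo.
  have -> : u = q + p by rewrite /q subrK.
  by rewrite !quadfE bilDl Aq add0r bilDr (bilC _ _ sA) Aq add0r.
rewrite (red H sH VH) (red G (proj1 psdG) gram_image).
have [p0|p0] := eqVneq p 0.
  have q00 A : quadf A (0 : 'cV[R]_d) = 0 by rewrite /quadf !mulmx0 mxE.
  by rewrite p0 !q00 /ediv eqxx -EFinB subrr abse_EFin normr0 lee_fin.
have pp : 0 < dotv p p.
  rewrite lt_def; apply/andP; split; first by apply: contra p0 => /eqP/dotv_eq0 ->.
  exact: dotv_ge0.
pose c := Num.sqrt (dotv p p); have c0 : 0 < c by rewrite sqrtr_gt0.
have Sv : data_sphere x (c^-1 *: p).
  split; first by apply: rpredZ; exact: QV.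
  apply/enorm_eq1; rewrite dotvZl dotvC dotvZl -[dotv p p]sqr_sqrtr ?ltW//.
  by rewrite -/c; field; rewrite gt_eqF.
have sc A : quadf A p = c ^+ 2 * quadf A (c^-1 *: p).
  by rewrite !quadfE bilZl bilZr; field; rewrite gt_eqF.
have g0 := gram_sphere_gt0 Sv.
have := is_Ghat_sphere GH Sv.
rewrite (sc H) (sc G); move: (quadf H _) (quadf G _) g0 => h g g0 hg.
have cg : 0 < c ^+ 2 * g by rewrite mulr_gt0// exprn_gt0.
rewrite /ediv [X in _ && X](_ : _ = false) ?andbF; last by apply/negbTE; rewrite eqe gt_eqF.
rewrite inver gt_eqF// -EFinM -EFinB abse_EFin lee_fin.
have -> : c ^+ 2 * h / (c ^+ 2 * g) - 1 = (h - g) / g by field; rewrite !gt_eqF.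
by rewrite normrM normfV (gtr0_norm g0) ler_pdivrMr.
Qed.

End deterministic.

(** * Moments under the law of the sample *)

Section law_of_sample.
Context {R : realType} {d : nat} {disp0 : measure_display}
  {T0 : measurableType disp0} (P0 : probability T0 R) (X : {RV P0 >-> borel_cV R d}).
Hypothesis gramX : gram_defined X.

Lemma dotv_entry_prod u v w : dotv u (X w) * dotv v (X w) =
  \sum_i \sum_j (u i 0 * v j 0) * entry_prod X i j w.
Proof.
rewrite !dotvE mulr_suml; apply: eq_bigr => i _; rewrite mulr_sumr.
by apply: eq_bigr => j _; rewrite /entry_prod; ring.
Qed.

Lemma intg_entry i j : intg P0 (entry_prod X i j).
Proof. exact: gramX. Qed.

Lemma intg_dotv_sample u v : intg P0 (fun w => dotv u (X w) * dotv v (X w)).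
Proof.
apply: (@eq_intg _ _ _ _ (fun w => \sum_i \sum_j (u i 0 * v j 0) * entry_prod X i j w)).
  by move=> w; rewrite dotv_entry_prod.
by apply: intg_sum => i; apply: intg_sum => j; apply: intgZ; exact: intg_entry.
Qed.

Lemma bil_gram u v : bil (gram X) u v = law_gram (distribution P0 X) u v.
Proof.
have -> : law_gram (distribution P0 X) u v = \int[P0]_w (dotv u (X w) * dotv v (X w)).
  rewrite /law_gram /Rintegral integral_distribution//.
    by apply/measurable_EFinP; apply: measurable_funM; exact: measurable_dotv.
  exact: intg_dotv_sample.
have -> : \int[P0]_w (dotv u (X w) * dotv v (X w)) =
    \int[P0]_w (\sum_i \sum_j (u i 0 * v j 0) * entry_prod X i j w).
  by apply: eq_Rintegral => w _; rewrite dotv_entry_prod.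
have ie i j : intg P0 (fun w => (u i 0 * v j 0) * entry_prod X i j w).
  by apply: intgZ; exact: intg_entry.
rewrite mean_sum; last by move=> i; exact: intg_sum.
rewrite bilE; apply: eq_bigr => i _; rewrite mean_sum//; apply: eq_bigr => j _.
rewrite meanZ; last exact: intg_entry.
by rewrite mxE unlock mulrC.
Qed.

Lemma psd_gram : psd (gram X).
Proof.
split.
  apply/matrixP => i j; rewrite !mxE; congr (fine ('E_P0[_])%E).
  by apply/funext => w; rewrite /entry_prod mulrC.
move=> u; rewrite quadfE bil_gram; apply: Rintegral_ge0 => x _.
by rewrite -expr2; exact: sqr_ge0.
Qed.

Variable kappa : R.
Hypothesis kurtosisX : (kurtosis_sup X <= kappa%:E)%E.

(** The kurtosis bound is applied to [u] rescaled by [(Num.sqrt s)^-1]. *)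
Lemma fourth_moment_le u s : 0 < s -> law_gram (distribution P0 X) u u <= s ->
  (\int[distribution P0 X]_x (dotv u x ^+ 4)%:E <= (kappa * s ^+ 2)%:E)%E.
Proof.
move=> s0 us.
have m4 : measurable_fun setT (fun x : borel_cV R d => dotv u x ^+ 4).
  by apply: measurable_funX; exact: measurable_dotv.
have pow4_ge0 (y : R) : 0 <= y ^+ 4 by exact: exprn_even_ge0.
pose c := (Num.sqrt s)^-1.
have c2 : c ^+ 2 = s^-1 by rewrite exprVn sqr_sqrtr// ltW.
have c4 : c ^+ 4 = s^-1 ^+ 2 by rewrite -c2 -exprM.
have law2 : \int[P0]_w (dotv u (X w) * dotv u (X w)) = law_gram (distribution P0 X) u u.
  rewrite /law_gram /Rintegral integral_distribution//.
    by apply/measurable_EFinP; apply: measurable_funM; exact: measurable_dotv.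
  exact: intg_dotv_sample.
have in_set : ('E_P0[fun w => (marginal X (c *: u) w ^+ 2)%R] <= 1)%E.
  rewrite unlock.
  have -> : (\int[P0]_w (marginal X (c *: u) w ^+ 2)%:E)%E =
      (\int[P0]_w (c ^+ 2 * (dotv u (X w) * dotv u (X w))))%:E.
    rewrite /Rintegral fineK; last first.
      apply: integrable_fin_num => //.
      by apply: (@intgZ _ _ _ P0 (c ^+ 2) (fun w => dotv u (X w) * dotv u (X w))); exact: intg_dotv_sample.
    by apply: eq_integral => w _; rewrite /marginal dotvZl; congr _%:E; ring.
  rewrite meanZ; last exact: intg_dotv_sample.
  by rewrite law2 lee_fin c2 mulrC ler_pdivrMr// mul1r.
have : ('E_P0[fun w => (marginal X (c *: u) w ^+ 4)%R] <= kappa%:E)%E.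
  by apply: le_trans kurtosisX; apply: ereal_sup_ubound; exists (c *: u).
rewrite unlock.
rewrite ge0_integral_distribution; first last.
- by move=> x; rewrite lee_fin.
- exact/measurable_EFinP.
under eq_integral do rewrite /marginal dotvZl exprMn EFinM.
have mX4 : measurable_fun setT (fun w => (dotv u (X w) ^+ 4)%:E).
  by apply/measurable_EFinP; exact: (measurableT_comp m4).
have X40 w : [set: T0] w -> (0%:E <= (dotv u (X w) ^+ 4)%:E)%E by rewrite lee_fin.
rewrite ge0_integralZl_EFin//.
rewrite c4 => h.
have s2 : (0 < s ^+ 2)%R by rewrite exprn_gt0.
rewrite mulrC EFinM -(@lee_pmul2l _ (s^-1 ^+ 2)%:E)//; last first.
  by rewrite lte_fin exprn_gt0// invr_gt0.
have e1 : s^-1 ^+ 2 * s ^+ 2 = 1 by rewrite -exprMn mulVf ?expr1n// gt_eqF.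
by rewrite muleA -(EFinM (s^-1 ^+ 2)) e1 mul1e.
Qed.

Lemma intg_fourth u : intg (distribution P0 X) (fun x => dotv u x ^+ 4).
Proof.
apply/integrableP; split.
  by apply/measurable_EFinP; apply: measurable_funX; exact: measurable_dotv.
pose s := law_gram (distribution P0 X) u u + 1.
have l0 : 0 <= law_gram (distribution P0 X) u u.
  by rewrite -bil_gram -quadfE; exact: (proj2 psd_gram).
have s0 : 0 < s by rewrite /s ltr_wpDl.
have us : law_gram (distribution P0 X) u u <= s by rewrite /s lerDl.
apply: le_lt_trans (le_trans _ (fourth_moment_le s0 us)) (ltry _).
by rewrite le_eqVlt; apply/orP; left; apply/eqP; apply: eq_integral => x _; rewrite /= ger0_norm// exprn_even_ge0.
Qed.

Lemma kurtosis_law u s : 0 < s -> law_gram (distribution P0 X) u u <= s ->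
  \int[distribution P0 X]_x (dotv u x ^+ 4) <= kappa * s ^+ 2.
Proof.
move=> s0 us; rewrite -lee_fin /Rintegral fineK; first exact: fourth_moment_le.
by apply: integrable_fin_num => //; exact: intg_fourth.
Qed.

End law_of_sample.

(** * The kernel of the form *)

Section kernel.
Context {R : realType} {d : nat}.

(** The residues of the canonical basis span the kernel of the form when [U]
    is a maximal orthonormal family.  Testing these finitely many vectors
    therefore tests orthogonality to the whole kernel. *)
Definition residue (G : 'M[R]_d) (r : nat) (U : 'I_r -> 'cV[R]_d) (k : 'I_d) : 'cV[R]_d :=
  delta_mx k 0 - \sum_j bil G (delta_mx k 0) (U j) *: U j.

Definition residue_sqr G r (U : 'I_r -> 'cV[R]_d) (x : 'cV[R]_d) : R :=
  \sum_k dotv (residue G U k) x ^+ 2.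

Lemma kernel_orthogonal G r (U : 'I_r -> 'cV[R]_d) (x u : 'cV[R]_d) : psd G ->
  residue_sqr G U x = 0 -> quadf G u = 0 -> dotv u x = 0.
Proof.
move=> pG h u0.
have res0 k : dotv (residue G U k) x = 0.
  move/eqP: h; rewrite /residue_sqr psumr_eq0 => [/allP h|i _]; last exact: sqr_ge0.
  by apply/eqP; have := h k (mem_index_enum k); rewrite /= sqrf_eq0.
have uE : u = \sum_k u k 0 *: delta_mx k 0.
  by rewrite {1}[u]matrix_sum_delta; apply: eq_bigr => k _; rewrite big_ord1.
suff -> : u = \sum_k u k 0 *: residue G U k.
  by rewrite dotv_suml big1// => k _; rewrite dotvZl res0 mulr0.
rewrite /residue; under eq_bigr do rewrite scalerBr.
rewrite sumrB -uE [X in _ - X](_ : _ = 0) ?subr0//.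
under eq_bigr do rewrite scaler_sumr.
rewrite exchange_big /= big1// => j _.
under eq_bigr do rewrite scalerA -bilZl.
by rewrite -scaler_suml -bil_suml -uE psd_bil0// scale0r.
Qed.

(** Each residue is isotropic, so the corresponding linear form has second
    moment zero. *)
Lemma law_residue_sqr (nu : probability (borel_cV R d) R) G r (U : 'I_r -> 'cV[R]_d) :
  (forall u, bil G u u = law_gram nu u u) ->
  (forall u v, intg nu (fun x => dotv u x * dotv v x)) ->
  (forall u, quadf G (u - \sum_j bil G u (U j) *: U j) = 0) ->
  measurable [set x : borel_cV R d | residue_sqr G U x = 0] /\
  nu [set x : borel_cV R d | residue_sqr G U x = 0] = 1%E.
Proof.
move=> lawE i2 res0; pose A : set (borel_cV R d) := [set x | residue_sqr G U x = 0].
rewrite -/A.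
have mf : measurable_fun setT (residue_sqr G U : borel_cV R d -> R).
  by apply: measurable_sum => k; apply: measurable_funX; exact: measurable_dotv.
have f0 (x : borel_cV R d) : 0 <= residue_sqr G U x.
  by apply: sumr_ge0 => k _; exact: sqr_ge0.
have mA : measurable A.
  have := mf measurableT [set 0] (measurable_set1 _).
  by rewrite setTI.
split => //.
have int0 : \int[nu]_x residue_sqr G U x = 0.
  rewrite /residue_sqr mean_sum => [|k]; last exact: eq_intg (i2 _ _).
  rewrite big1// => k _; rewrite -[LHS]/(law_gram nu (residue G U k) (residue G U k)).
  by rewrite -lawE -quadfE res0.
have iF : intg nu (residue_sqr G U : borel_cV R d -> R).
  by apply: intg_sum => k; exact: eq_intg (i2 _ _).
have : (\int[nu]_x `|(EFin \o residue_sqr G U) x| = 0)%E.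
  rewrite -[RHS](congr1 EFin int0) /Rintegral fineK; last exact: integrable_fin_num.
  by apply: eq_integral => x _; rewrite /= ger0_norm.
move/ae_eq_integral_abs => /(_ measurableT) [].
  exact/measurable_EFinP.
move=> N [mN N0 sub].
have nA : nu (~` A) = 0%E.
  apply: (subset_measure0 (measurableC mA) mN _ N0).
  apply: subset_trans sub => x /= hx h; apply: hx.
  by have := h I => -[].
have := @probability_setC _ _ _ nu _ mA; rewrite nA => /esym/eqP.
rewrite -{1}(@fineK _ (nu A)) ?fin_num_measure//.
by rewrite -EFinB eqe subr_eq0 => /eqP h; rewrite -[LHS]fineK ?fin_num_measure// -h.
Qed.

End kernel.

(** * Cost of the randomization at the chosen precision *)

Section budget.
Context {R : realType}.
Variables (d n : nat) (kappa eps : R).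

(** The relations between the parameters that the deviation estimates use;
    [lambda * (kappa - 1)] and [D = Num.sqrt (kappa * d / n)] measure the
    contributions of the confidence level and of the dimension to [mu], and
    [reg_delta] is the definition of [delta] cleared of its denominator. *)
Record regime (lambda D mu delta : R) : Prop := Regime {
  reg_n : 0 < n%:R :> R;
  reg_kappa : 1 < kappa;
  reg_lambda : 0 < lambda;
  reg_D : 0 < D;
  reg_D2 : D ^+ 2 = kappa * d%:R / n%:R;
  reg_d : 6 / 5 * d%:R <= n%:R * (lambda * D);
  reg_ln : ln eps^-1 = n%:R * (lambda ^+ 2 * (kappa - 1) / 2) - 73 / 100 * d%:R;
  reg_mu : lambda * (kappa - 1) + 906 / 100 * D <= mu;
  reg_delta : delta = mu + 2 * mu * delta;
  reg_delta0 : 0 < delta;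
  reg_mu4 : mu < 1 / 4;
  reg_small : lambda * (kappa - 1) + lambda + 4 * mu < 2
}.

(** At the precision [lambda * n * D] the entropy [3 * beta * s] and the
    randomization cost are both of order [n * lambda * D * s].  The remaining
    [5 * d] is paid by the [0.73 * d] of the logarithmic term and, for the
    other [4.27 * d], by [reg_d]: [4.27 * 5 / 6 <= 89 / 25]. *)
Lemma budget (lambda D mu delta l s r : R) : regime lambda D mu delta ->
  l ^+ 2 = lambda ^+ 2 -> 0 <= s -> 0 <= r <= d%:R ->
  let beta := lambda * n%:R * D in
  3 * (beta * s) + ln eps^-1 +
    n%:R * (l * (s - 1) + l ^+ 2 / 2 * ((kappa - 1) * s ^+ 2 + (s - 1) ^+ 2)
      + 5 / 2 * l ^+ 2 * (kappa * (r * s) / beta)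
      + 5 * l ^+ 2 * (kappa * r ^+ 2 / beta ^+ 2))
  <= n%:R * (l * (s - 1)
      + lambda ^+ 2 / 2 * ((kappa - 1) * (s ^+ 2 + 1) + (s - 1) ^+ 2)
      + lambda * D * (11 / 2 * s + 89 / 25)).
Proof.
case=> n0 k1 l0 D0 D2 dl lnE _ _ _ _ _ l2 s0 /andP[r0 rd] /=.
set beta := _ * D.
have be0 : 0 < beta by rewrite /beta !mulr_gt0.
have k0 : 0 < kappa by lra.
have e1 : 5 / 2 * l ^+ 2 * (kappa * (r * s) / beta) <= 5 / 2 * (lambda * D * s).
  apply: (@le_trans _ _ (5 / 2 * l ^+ 2 * (kappa * (d%:R * s) / beta))).
    apply: ler_wpM2l; first by rewrite mulr_ge0 ?sqr_ge0.
    apply: ler_wpM2r; first by rewrite invr_ge0 ltW.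
    by apply: ler_wpM2l (ltW k0) _ _ _; apply: ler_wpM2r.
  rewrite le_eqVlt; apply/orP; left; apply/eqP.
  have kd : kappa * d%:R = D ^+ 2 * n%:R by rewrite D2 divfK// gt_eqF.
  by rewrite mulrA kd l2 /beta; field; rewrite !gt_eqF.
have e2 : 5 * l ^+ 2 * (kappa * r ^+ 2 / beta ^+ 2) <= 5 * d%:R / n%:R.
  apply: (@le_trans _ _ (5 * l ^+ 2 * (kappa * d%:R ^+ 2 / beta ^+ 2))).
    apply: ler_wpM2l; first by rewrite mulr_ge0 ?sqr_ge0.
    apply: ler_wpM2r; first by rewrite invr_ge0 ltW// exprn_gt0.
    apply: ler_wpM2l (ltW k0) _ _ _; rewrite ler_pXn2r ?nnegrE//.
  rewrite le_eqVlt; apply/orP; left; apply/eqP.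
  have kd : kappa * d%:R ^+ 2 = D ^+ 2 * n%:R * d%:R.
    by rewrite D2 divfK ?gt_eqF//; ring.
  by rewrite kd l2 /beta; field; rewrite !gt_eqF.
have E1 : n%:R * (5 / 2 * l ^+ 2 * (kappa * (r * s) / beta)) <= n%:R * (5 / 2 * (lambda * D * s)).
  by apply: ler_wpM2l => //; exact: ltW.
have E2 : n%:R * (5 * l ^+ 2 * (kappa * r ^+ 2 / beta ^+ 2)) <= 5 * d%:R.
  apply: (@le_trans _ _ (n%:R * (5 * d%:R / n%:R))); first by apply: ler_wpM2l => //; exact: ltW.
  by rewrite le_eqVlt; apply/orP; left; apply/eqP; field; rewrite gt_eqF.
have eB : 3 * (beta * s) = 3 * (n%:R * (lambda * D * s)) by rewrite /beta; ring.
rewrite eB lnE !mulrDr; rewrite l2 in E1 E2 *.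
set A1 := n%:R * (5 / 2 * _ * _) in E1 *; set A2 := n%:R * (5 * _ * _) in E2 *.
have := dl; lra.
Qed.

(** The coefficients satisfy [11 / 2 + 89 / 25 = 9.06], so the first order
    terms add up to at most [mu] while [delta] exceeds [mu] by
    [2 * mu * delta], at least the remaining second order term. *)
Lemma upper_budget (lambda D mu delta s : R) : regime lambda D mu delta ->
  s = 1 - delta ->
  lambda * (s - 1) + lambda ^+ 2 / 2 * ((kappa - 1) * (s ^+ 2 + 1) + (s - 1) ^+ 2)
      + lambda * D * (11 / 2 * s + 89 / 25) <= 0.
Proof.
case=> n0 k1 l0 D0 D2 dl lnE muE dE d0 mu4 small sE.
have mu0 : 0 < mu by nra.
have d1 : delta < 1 / 2 by nra.
rewrite [leLHS](_ : _ = lambda * (- delta + lambda * (kappa - 1) / 2 * (s ^+ 2 + 1)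
   + lambda * delta ^+ 2 / 2 + D * (11 / 2 * s + 89 / 25))); last by rewrite sE; field.
rewrite pmulr_rle0//.
have m0 : 0 < lambda * (kappa - 1) by rewrite mulr_gt0//; lra.
set m := lambda * (kappa - 1) in muE small m0 *.
have h1 : m / 2 * (s ^+ 2 + 1) <= m / 2 * 2 by apply: ler_wpM2l; rewrite ?sE; [lra|nra].
have h2 : D * (11 / 2 * s + 89 / 25) <= D * (906 / 100).
  by apply: ler_wpM2l; [exact: ltW|rewrite ?sE; lra].
have h3 : lambda * delta ^+ 2 / 2 <= 2 * mu * delta.
  have -> : lambda * delta ^+ 2 / 2 = delta * (lambda * delta / 2) by ring.
  rewrite mulrC [leRHS]mulrC mulrC; apply: ler_wpM2l; first exact: ltW.
  have : lambda * delta <= 2 * delta by apply: ler_wpM2r; lra.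
  have : delta <= 2 * mu by nra.
  lra.
lra.
Qed.

(** Here the first order terms add up to at most [mu * (1 + delta)], which
    leaves [mu * delta]; the sample size condition, in the form [reg_small], says
    that this covers the second order terms. *)
Lemma lower_budget (lambda D mu delta s : R) : regime lambda D mu delta ->
  s = 1 + delta ->
  - lambda * (s - 1) + lambda ^+ 2 / 2 * ((kappa - 1) * (s ^+ 2 + 1) + (s - 1) ^+ 2)
      + lambda * D * (11 / 2 * s + 89 / 25) < 0.
Proof.
case=> n0 k1 l0 D0 D2 dl lnE muE dE d0 mu4 small sE.
have mu0 : 0 < mu by nra.
have d1 : delta < 1 / 2 by nra.
rewrite [ltLHS](_ : _ = lambda * (- delta + lambda * (kappa - 1) / 2 * (s ^+ 2 + 1)
   + lambda * delta ^+ 2 / 2 + D * (11 / 2 * s + 89 / 25))); last by rewrite sE; field.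
rewrite pmulr_rlt0//.
have m0 : 0 < lambda * (kappa - 1) by rewrite mulr_gt0//; lra.
set m := lambda * (kappa - 1) in muE small m0 *.
have h2 : D * (11 / 2 * s + 89 / 25) <= (906 / 100 * D) * (1 + delta).
  have -> : 906 / 100 * D * (1 + delta) = D * (906 / 100 * (1 + delta)) by ring.
  by apply: ler_wpM2l; [exact: ltW|rewrite ?sE; lra].
have h4 : (m + 906 / 100 * D) * (1 + delta) <= mu * (1 + delta) by apply: ler_wpM2r; lra.
have h5 : (m + lambda) * delta < 2 * mu.
  have : (m + lambda) * delta < (2 - 4 * mu) * delta by rewrite ltr_pM2r//; lra.
  lra.
have h6 : delta * ((m + lambda) * delta) < delta * (2 * mu) by rewrite ltr_pM2l.
have -> : m / 2 * (s ^+ 2 + 1) = m * (1 + delta) + m * delta ^+ 2 / 2 by rewrite sE; field.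
move: h6; rewrite (_ : delta * ((m + lambda) * delta) = m * delta ^+ 2 + lambda * delta ^+ 2); last by ring.
lra.
Qed.

End budget.

(** * Consequences of the sample size condition *)

Section parameters.
Context {R : realType}.

Lemma ler_of_sqr (a b : R) : 0 <= b -> a ^+ 2 <= b ^+ 2 -> a <= b.
Proof. by move=> b0 h; rewrite leNgt; apply/negP => ab; nra. Qed.

(** Everything is homogeneous in [Num.sqrt n]; dividing the sample size
    condition by it gives the last inequality.  The constants come from
    [9.06 <= 6.81 * Num.sqrt 2 <= 10]. *)
Lemma sample_size_facts (d n : nat) (kappa eps : R) : 1 < kappa ->
  0 <= log_term d eps -> sample_size_cond d n kappa eps ->
  let lambda := lambda_of d n kappa eps in
  let D := Num.sqrt (kappa * d%:R / n%:R) in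
  [/\ 0 < n%:R :> R,
      Num.sqrt (2 * (kappa - 1) / n%:R * log_term d eps) = lambda * (kappa - 1),
      906 / 100 * D <= 681 / 100 * Num.sqrt (2 * kappa * d%:R / n%:R) <= 10 * D &
      5 / 2 * (lambda * (kappa - 1)) + lambda / 2 + 20 * D < 1].
Proof.
move=> k1 L0; rewrite /sample_size_cond /lambda_of; set L := log_term d eps in L0 *.
move=> cond /=.
have n0 : 0 < n%:R :> R by apply: le_lt_trans (sqr_ge0 _) cond.
have d0 : 0 <= d%:R :> R by [].
have k0 : 0 < kappa - 1 by lra.
set lambda := Num.sqrt (2 / ((kappa - 1) * n%:R) * L); set D := Num.sqrt (kappa * d%:R / n%:R).
have l0 : 0 <= lambda by exact: sqrtr_ge0.
have D0 : 0 <= D by exact: sqrtr_ge0.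
have l2 : lambda ^+ 2 = 2 / ((kappa - 1) * n%:R) * L.
  by rewrite sqr_sqrtr// mulr_ge0// divr_ge0// mulr_ge0// ltW.
have D2 : D ^+ 2 = kappa * d%:R / n%:R.
  rewrite sqr_sqrtr//; apply: divr_ge0 (ltW n0); apply: mulr_ge0 => //; lra.
have mE : Num.sqrt (2 * (kappa - 1) / n%:R * L) = lambda * (kappa - 1).
  have -> : 2 * (kappa - 1) / n%:R * L = (lambda * (kappa - 1)) ^+ 2.
    by rewrite exprMn l2; field; rewrite !gt_eqF.
  by rewrite sqrtr_sqr ger0_norm// mulr_ge0// ltW.
split => //.
  have y2 : Num.sqrt (2 * kappa * d%:R / n%:R) ^+ 2 = 2 * D ^+ 2.
    rewrite sqr_sqrtr; first by rewrite D2; ring.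
    apply: divr_ge0 (ltW n0); apply: mulr_ge0 => //; lra.
  have y0 := sqrtr_ge0 (2 * kappa * d%:R / n%:R).
  move: (Num.sqrt (2 * kappa * d%:R / n%:R)) y0 y2 => y y0 y2.
  apply/andP; split.
    apply: ler_of_sqr; first by lra.
    by rewrite [leLHS]exprMn [leRHS]exprMn y2; have := sqr_ge0 D; lra.
  apply: ler_of_sqr; first by lra.
  by rewrite [leLHS]exprMn [leRHS]exprMn y2; have := sqr_ge0 D; lra.
pose q := Num.sqrt (n%:R : R).
have q0 : 0 < q by rewrite sqrtr_gt0.
have q2 : q ^+ 2 = n%:R by rewrite sqr_sqrtr// ltW.
have eD : Num.sqrt (kappa * d%:R) = D * q.
  have -> : kappa * d%:R = (D * q) ^+ 2 by rewrite exprMn D2 q2 divfK// gt_eqF.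
  by rewrite sqrtr_sqr ger0_norm// mulr_ge0// ltW.
have eM : Num.sqrt (2 * (kappa - 1) * L) = lambda * (kappa - 1) * q.
  have -> : 2 * (kappa - 1) * L = (lambda * (kappa - 1) * q) ^+ 2.
    by rewrite !exprMn l2 q2; field; rewrite !gt_eqF.
  by rewrite sqrtr_sqr ger0_norm// !mulr_ge0// ltW.
move: cond; rewrite eD eM -q2.
have -> : 20 * (D * q) + (5 / 2 + 1 / (2 * (kappa - 1))) * (lambda * (kappa - 1) * q)
   = (5 / 2 * (lambda * (kappa - 1)) + lambda / 2 + 20 * D) * q.
  by field; rewrite gt_eqF.
set A := 5 / 2 * _ + _ + _.
have A0 : 0 <= A.
  have : 0 <= lambda * (kappa - 1) by rewrite mulr_ge0// ltW.
  by rewrite /A; lra.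
rewrite exprMn => h; have q20 : 0 < q ^+ 2 by rewrite exprn_gt0.
have : A ^+ 2 < 1 by rewrite -(ltr_pM2r q20) mul1r.
by move=> A1; rewrite ltNge; apply/negP => A2; nra.
Qed.

(** The term [0.73 * d] in the definition of [lambda] bounds it from below:
    [(lambda * D) ^+ 2] is at least [1.46 * (d / n) ^+ 2], and
    [(6 / 5) ^+ 2 <= 1.46] gives [reg_d]. *)
Lemma regime_params (d n : nat) (kappa eps : R) : 1 < kappa -> 0 < eps < 1 -> (0 < d)%N ->
  sample_size_cond d n kappa eps -> 0 < delta_of d n kappa eps < 1 / 2 ->
  regime d n kappa eps (lambda_of d n kappa eps) (Num.sqrt (kappa * d%:R / n%:R))
    (mu_of d n kappa eps) (delta_of d n kappa eps).
Proof.
move=> k1 /andP[e0 e1] d0 cond /andP[dl0 dl1].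
have d1 : 1 <= d%:R :> R by rewrite ler1n.
have ln0 : 0 < ln eps^-1 by rewrite ln_gt0// invf_gt1.
have L0 : 0 < log_term d eps by rewrite /log_term; lra.
have [n0 mE /andP[yD Dy] small] := sample_size_facts k1 (ltW L0) cond.
have lambdaE : lambda_of d n kappa eps ^+ 2 = 2 / ((kappa - 1) * n%:R) * log_term d eps.
  rewrite sqr_sqrtr//; apply: mulr_ge0 (ltW L0); apply: divr_ge0 => //.
  by apply: mulr_ge0 (ltW n0); lra.
have l0 : 0 < lambda_of d n kappa eps.
  rewrite sqrtr_gt0 mulr_gt0// divr_gt0// mulr_gt0//; lra.
set D := Num.sqrt (kappa * d%:R / n%:R) in yD Dy small *.
have D2 : D ^+ 2 = kappa * d%:R / n%:R.
  rewrite sqr_sqrtr//; apply: divr_ge0 (ltW n0); apply: mulr_ge0; lra.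
have D0 : 0 < D by rewrite sqrtr_gt0 divr_gt0// mulr_gt0//; lra.
move: mE lambdaE l0 small; set lambda := lambda_of _ _ _ _ => mE lambdaE l0 small.
have muE : mu_of d n kappa eps = lambda * (kappa - 1) + 681 / 100 * Num.sqrt (2 * kappa * d%:R / n%:R).
  by rewrite /mu_of mE.
have m0 : 0 < lambda * (kappa - 1) by rewrite mulr_gt0//; lra.
set mu := mu_of _ _ _ _ in muE *.
have mu0 : 0 < mu by rewrite muE; lra.
have mu2 : 0 < 1 - 2 * mu by rewrite muE; lra.
have dE : delta_of d n kappa eps = mu / (1 - 2 * mu) by [].
have mu4 : mu < 1 / 4.
  by move: dl1; rewrite dE ltr_pdivrMr//; lra.
split => //.
- apply: ler_of_sqr; first by apply/ltW; rewrite !mulr_gt0.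
  rewrite exprMn [leRHS]exprMn [(_ * D) ^+ 2]exprMn D2 lambdaE.
  rewrite [leRHS](_ : _ = 2 * log_term d eps * d%:R * (kappa / (kappa - 1))); last first.
    by field; rewrite !gt_eqF//; lra.
  have k2 : 1 <= kappa / (kappa - 1) by rewrite ler_pdivlMr; lra.
  apply: (@le_trans _ _ (2 * log_term d eps * d%:R * 1)); last first.
    by apply: ler_wpM2l k2; rewrite !mulr_ge0// ltW.
  rewrite mulr1 expr2 [leLHS](_ : _ = 36 / 25 * d%:R * d%:R); last by field.
  by apply: ler_wpM2r; rewrite // /log_term; lra.
- rewrite lambdaE /log_term; field; rewrite !gt_eqF//; lra.
- by rewrite muE; lra.
- by rewrite dE; field; rewrite gt_eqF.
- by rewrite muE; lra.
Qed.

(** Both terms of [mu] are at most a multiple of the rate, and the bound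
    [delta <= eta < 1 / 2] keeps [1 - 4 * mu] away from zero. *)
Lemma accuracy_rate (eta : R) : 0 < eta < 1 / 2 ->
  exists c : R, forall (d n : nat) (kappa eps : R),
    let mu := mu_of d n kappa eps in
    1 < kappa -> 0 < eps <= 1 -> sample_size_cond d n kappa eps ->
    delta_of d n kappa eps <= eta ->
    2 * mu / (1 - 4 * mu) <= c * Num.sqrt (kappa * (d%:R + ln eps^-1) / n%:R).
Proof.
move=> /andP[eta0 eta1]; exists (24 * (1 + 2 * eta) / (1 - 2 * eta)).
move=> d n kappa eps mu k1 /andP[e0 e1] cond dl.
have d0 : 0 <= d%:R :> R by [].
have ln0 : 0 <= ln eps^-1 by rewrite ln_ge0// invf_ge1.
have L0 : 0 <= log_term d eps by rewrite /log_term; lra.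
have [n0 mE /andP[yD Dy] small] := sample_size_facts k1 L0 cond.
have l0 : 0 <= lambda_of d n kappa eps by exact: sqrtr_ge0.
have muE : mu = Num.sqrt (2 * (kappa - 1) / n%:R * log_term d eps)
   + 681 / 100 * Num.sqrt (2 * kappa * d%:R / n%:R) by [].
set Z := Num.sqrt (kappa * (d%:R + ln eps^-1) / n%:R).
have i0 : 0 <= n%:R^-1 :> R by rewrite invr_ge0 ltW.
have h1 : Num.sqrt (2 * (kappa - 1) / n%:R * log_term d eps) <= 2 * Z.
  apply: ler_of_sqr; first by rewrite mulr_ge0// sqrtr_ge0.
  rewrite exprMn sqr_sqrtr; last by apply: mulr_ge0 => //; apply: mulr_ge0 => //; lra.
  rewrite sqr_sqrtr; last by apply: mulr_ge0 => //; apply: mulr_ge0; lra.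
  rewrite [leLHS](_ : _ = n%:R^-1 * (2 * ((kappa - 1) * log_term d eps))); last by ring.
  rewrite [leRHS](_ : _ = n%:R^-1 * (2 * (kappa * (2 * (d%:R + ln eps^-1))))); last by ring.
  apply: ler_wpM2l => //; apply: ler_wpM2l => //; apply: ler_pM => //; rewrite ?/log_term; lra.
have h2 : Num.sqrt (kappa * d%:R / n%:R) <= Z.
  apply: ler_wsqrtr; apply: ler_wpM2r => //; apply: ler_wpM2l; lra.
have Z0 : 0 <= Z by exact: sqrtr_ge0.
have mu0 : 0 <= mu.
  rewrite muE; have := sqrtr_ge0 (2 * (kappa - 1) / n%:R * log_term d eps).
  by have := sqrtr_ge0 (2 * kappa * d%:R / n%:R); lra.
have mu12 : mu <= 12 * Z by rewrite muE; lra.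
have mu2 : 0 < 1 - 2 * mu.
  have := sqrtr_ge0 (kappa * d%:R / n%:R).
  have : 0 <= lambda_of d n kappa eps * (kappa - 1) by rewrite mulr_ge0//; lra.
  by move: small Dy; rewrite muE mE; lra.
have mu_eta : mu * (1 + 2 * eta) <= eta.
  move: dl; rewrite /delta_of -/mu ler_pdivrMr//; lra.
have D1 : 0 < 1 - 2 * eta by lra.
have D2 : 0 < 1 - 4 * mu.
  have : (1 - 4 * mu) * (1 + 2 * eta) >= 1 - 2 * eta by lra.
  move=> h; rewrite -(@pmulr_lgt0 _ (1 + 2 * eta)); lra.
rewrite ler_pdivrMr// mulrAC -mulrA mulrAC ler_pdivlMr//.
have : 2 * mu * (1 - 2 * eta) <= 24 * Z * (1 - 2 * eta) by apply: ler_wpM2r; lra.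
have : 24 * Z * (1 - 2 * eta) <= 24 * Z * ((1 - 4 * mu) * (1 + 2 * eta)).
  by apply: ler_wpM2l; lra.
lra.
Qed.

End parameters.

(** * Simultaneous accuracy in all directions *)

Lemma probability_setI_ge {R : realType} {disp : measure_display} {T : measurableType disp}
    (P : probability T R) (A B : set T) (a b : R) : measurable A -> measurable B ->
  ((1 - a)%R%:E <= P A)%E -> ((1 - b)%R%:E <= P B)%E -> ((1 - (a + b))%R%:E <= P (A `&` B))%E.
Proof.
move=> mA mB hA hB.
have mAB : measurable (A `&` B) by exact: measurableI.
have fin C : measurable C -> P C = (fine (P C))%:E by move=> mC; rewrite fineK// fin_num_measure.
have : (P (~` (A `&` B)) <= P (~` A) + P (~` B))%E.
  by rewrite setCI; apply: measureU2; exact: measurableC.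
rewrite !probability_setC//; move: hA hB; rewrite (fin _ mA) (fin _ mB) (fin _ mAB) -!EFinB -EFinD !lee_fin.
by lra.
Qed.

(** The defining sum of the directional estimate is nonincreasing in [rho]. It
    is nonpositive at [quadf G u / (1 - delta)] and positive at
    [quadf G u / (1 + delta)]: these are the deviation bounds for the multiples
    of [u] on which the form equals [1 - delta] and [1 + delta]. *)
Lemma Nhat_bracket {R : realType} (d n : nat) (kappa eps lambda D mu delta : R)
    (x : 'I_n -> 'cV[R]_d) (G : 'M[R]_d) (u : 'cV[R]_d) :
  regime d n kappa eps lambda D mu delta ->
  (forall l v, (l = lambda \/ l = - lambda) -> 0 < quadf G v < 2 ->
    \sum_i psi (l * (dotv v (x i) ^+ 2 - 1)) <=
    n%:R * (l * (quadf G v - 1)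
      + lambda ^+ 2 / 2 * ((kappa - 1) * (quadf G v ^+ 2 + 1) + (quadf G v - 1) ^+ 2)
      + lambda * D * (11 / 2 * quadf G v + 89 / 25))) ->
  0 < quadf G u ->
  (1 - delta) * Nhat lambda x u <= quadf G u <= (1 + delta) * Nhat lambda x u.
Proof.
move=> reg dev g0; set g := quadf G u in g0 *.
have [n0 _ l0 _ _ _ _ _ dE dl0 mu4 _] := reg.
have dl1 : delta < 1 / 2 by nra.
pose A := [set rho : R | 0 < rho /\
    \sum_(i < n) psi (lambda * (rho^-1 * dotv u (x i) ^+ 2 - 1)) <= 0].
have scale rho : 0 < rho -> quadf G ((Num.sqrt rho)^-1 *: u) = g / rho.
  move=> r0; rewrite quadfE bilZl bilZr mulrA -expr2 exprVn sqr_sqrtr ?ltW//.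
  by rewrite mulrC.
have scale2 rho i : 0 < rho ->
    rho^-1 * dotv u (x i) ^+ 2 = dotv ((Num.sqrt rho)^-1 *: u) (x i) ^+ 2.
  by move=> r0; rewrite dotvZl exprMn exprVn sqr_sqrtr ?ltW.
have p1 : 0 < 1 - delta by lra.
have p2 : 0 < 1 + delta by lra.
have A1 : A (g / (1 - delta)).
  have r0 : 0 < g / (1 - delta) by rewrite divr_gt0.
  split => //; under eq_bigr do rewrite scale2//.
  set v := _ *: u.
  have sE : quadf G v = 1 - delta by rewrite scale//; field; rewrite !gt_eqF.
  have := dev lambda v (or_introl erefl); rewrite sE => h.
  apply: le_trans (h _) _; first by apply/andP; split; lra.
  by rewrite pmulr_rle0//; exact: upper_budget reg erefl.
apply/andP; split.
  rewrite mulrC -ler_pdivlMr//; apply: ge_inf => //.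
  by exists 0 => r [/ltW].
rewrite mulrC -ler_pdivrMr//; apply: lb_le_inf; first by exists (g / (1 - delta)).
move=> rho [r0 hr]; rewrite leNgt; apply/negP => lt.
have r1 : 0 < g / (1 + delta) by rewrite divr_gt0.
pose v := (Num.sqrt (g / (1 + delta)))^-1 *: u.
have sE : quadf G v = 1 + delta by rewrite /v scale//; field; rewrite !gt_eqF.
have := dev (- lambda) v (or_intror erefl); rewrite sE => h.
have {}h : \sum_i psi (- lambda * (dotv v (x i) ^+ 2 - 1)) < 0.
  apply: le_lt_trans (h _) _; first by apply/andP; split; lra.
  by rewrite pmulr_rlt0//; exact: lower_budget reg erefl.
have : \sum_i psi (lambda * (dotv v (x i) ^+ 2 - 1)) <= 0.
  apply: le_trans hr; apply: ler_sum => i _; apply: psi_le.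
  apply: ler_wpM2l; first exact: ltW.
  rewrite lerD2r -scale2//; apply: ler_wpM2r; first exact: sqr_ge0.
  by rewrite lef_pV2 ?posrE// ltW.
move: h; under eq_bigr do rewrite mulNr psiN.
by rewrite sumrN oppr_lt0 => h1 h2; have := lt_le_trans h1 h2; rewrite ltxx.
Qed.

Section sampling.
Context {R : realType} {d n : nat} {disp0 disp : measure_display}
  {T0 : measurableType disp0} (P0 : probability T0 R)
  {T : measurableType disp} (P : probability T R).
Variables (X : {RV P0 >-> borel_cV R d}) (Xs : 'I_n -> {RV P >-> borel_cV R d}).

Lemma sample_independence : mutually_independent Xs -> (forall i, same_law (Xs i) X) ->
  forall B : 'I_n -> set (borel_cV R d), (forall i, measurable (B i)) ->
  P [set w | forall i, B i (Xs i w)] = (\prod_i distribution P0 X (B i))%E.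
Proof.
move=> ind law B mB; have := ind [set: 'I_n]%SET B mB.
rewrite (_ : [set w | forall i, i \in _ -> _] = [set w | forall i, B i (Xs i w)]).
  move=> ->; apply: eq_big => [i|i _]; first by rewrite inE.
  exact: law i (B i) (mB i).
by apply/seteqP; split => w h i; [apply: h; rewrite inE|move=> _; exact: h].
Qed.

(** Three events are intersected: a deviation bound for each sign of
    [lambda], and the almost sure orthogonality of the sample to the kernel of
    the form.  The last one reduces a general direction to a combination of
    the orthonormal family, and settles the directions in the kernel. *)
Lemma uniform_bracket (kappa eps : R) :
  let lambda := lambda_of d n kappa eps in
  let delta := delta_of d n kappa eps in
  1 < kappa -> 0 < eps < 1 -> sample_size_cond d n kappa eps -> 0 < delta < 1 / 2 ->
  gram_defined X -> (kurtosis_sup X <= kappa%:E)%E ->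
  mutually_independent Xs -> (forall i, same_law (Xs i) X) ->
  exists E : set T, [/\ measurable E, ((1 - 2 * eps)%R%:E <= P E)%E &
    forall w, E w ->
      (forall u, (1 - delta) * Nhat lambda (fun i => Xs i w) u <= quadf (gram X) u
                 <= (1 + delta) * Nhat lambda (fun i => Xs i w) u) /\
      (forall u, quadf (gram X) u = 0 -> forall i, dotv u (Xs i w) = 0)].
Proof.
move=> lambda delta k1 e01 cond dl01 gX kX ind law.
have /andP[e0 e1] := e01.
set nu := distribution P0 X.
have pG := psd_gram gX.
have indep := sample_independence ind law.
have [r [U [rd _ orU resU]]] := orthonormal_family fullv pG.
have {}resU u := resU u (memvf u).
have orU' i j : law_gram nu (U i) (U j) = (i == j)%:R by rewrite -bil_gram.
have lawE u : bil (gram X) u u = law_gram nu u u by exact: bil_gram.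
have i4 := intg_fourth gX kX.
have k4 := kurtosis_law gX kX.
have i2 := intg_dotv2 i4.
have mX i : measurable_fun setT (Xs i : T -> borel_cV R d) by exact: measurable_funP.
have [mK nuK] := law_residue_sqr lawE i2 resU.
pose A : set (borel_cV R d) := [set x | residue_sqr (gram X) U x = 0].
rewrite -/A in mK nuK.
pose K := [set w | forall i, A (Xs i w)].
have PK : P K = 1%E.
  rewrite /K (indep (fun=> A))// big1// => i _; exact: nuK.
have mKK : measurable K.
  rewrite (_ : K = \bigcap_(i in [set: 'I_n]) (Xs i @^-1` A)); last first.
    by apply/seteqP; split => w h i; [move=> _; exact: h|exact: h].
  by apply: fin_bigcap_measurable => // i _; rewrite -[_ @^-1` _]setTI; exact: mX.
have l2 l : (l = lambda \/ l = - lambda) -> l ^+ 2 = lambda ^+ 2.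
  by case=> ->; rewrite ?sqrrN.
set D := Num.sqrt (kappa * d%:R / n%:R).
set mu := mu_of d n kappa eps.
have onesided l : (l = lambda \/ l = - lambda) -> exists E : set T,
    [/\ measurable E, ((1 - eps)%R%:E <= P E)%E & forall w, E w -> K w ->
     (0 < d)%N -> forall v, 0 < quadf (gram X) v < 2 ->
    \sum_i psi (l * (dotv v (Xs i w) ^+ 2 - 1)) <=
    n%:R * (l * (quadf (gram X) v - 1)
      + lambda ^+ 2 / 2 * ((kappa - 1) * (quadf (gram X) v ^+ 2 + 1) + (quadf (gram X) v - 1) ^+ 2)
      + lambda * D * (11 / 2 * quadf (gram X) v + 89 / 25))].
  move=> ll; have [d0|d0] := posnP d.
    exists setT; split => //.
    by rewrite probability_setT lee_fin; lra.
  have reg := regime_params k1 e01 d0 cond dl01.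
  have [n0 _ la0 D0 _ _ _ _ _ _ _ _] := reg.
  pose beta := lambda * n%:R * D.
  have be0 : 0 < beta by rewrite /beta !mulr_gt0.
  (* Only directions with [quadf (gram X) v < 2] occur below. *)
  pose M := (Num.bound (2 * beta)).+1.
  have HM : 2 * beta < M%:R.
    apply: lt_le_trans (archi_boundP _) _; first by lra.
    by rewrite ler_nat.
  have [E [mE PE HE]] := deviation_bound i4 k4 orU' l mX indep e0 be0 (ltn0Sn _ : (0 < M)%N).
  exists E; split => // w Ew Kw _ v /andP[s0 s2].
  pose th j := bil (gram X) v (U j).
  pose k := v - comb U th.
  have k0 : quadf (gram X) k = 0 by exact: resU.
  have kx i : dotv k (Xs i w) = 0.
    by apply: kernel_orthogonal k0 => //; exact: Kw.
  have vx i : dotv v (Xs i w) = dotv (comb U th) (Xs i w).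
    by rewrite -[v](subrK (comb U th)) dotvDl kx add0r.
  have sE : quadf (gram X) v = \sum_j th j ^+ 2.
    rewrite -(law_gram_comb i4 orU' th) -bil_gram// -[v](subrK (comb U th)) -/k.
    rewrite quadfE bilDl psd_bil0// add0r bilDr bilC ?(proj1 pG)//.
    by rewrite psd_bil0// add0r.
  under eq_bigr do rewrite vx.
  apply: le_trans (HE w Ew th _ sE s0 _) _.
    by apply: le_lt_trans HM; rewrite mulrC; apply: ler_wpM2r; lra.
  apply: budget reg _ _ _ => //; first exact: l2.
    exact: ltW.
  by rewrite ler0n ler_nat.
have [E1 [mE1 PE1 HE1]] := onesided lambda (or_introl erefl).
have [E2 [mE2 PE2 HE2]] := onesided (- lambda) (or_intror erefl).
exists (E1 `&` E2 `&` K); split.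
- by apply: measurableI => //; exact: measurableI.
- rewrite (_ : 1 - 2 * eps = 1 - (eps + eps + 0)); last by ring.
  apply: probability_setI_ge => //; first exact: measurableI.
    exact: probability_setI_ge.
  by rewrite PK subr0.
move=> w [[w1 w2] Kw].
have ker u : quadf (gram X) u = 0 -> forall i, dotv u (Xs i w) = 0.
  by move=> u0 i; apply: kernel_orthogonal u0 => //; exact: Kw.
split => // u.
have [u0|u0] := eqVneq (quadf (gram X) u) 0.
  by rewrite u0 Nhat_eq0 ?mulr0 ?lexx//; [exact: sqrtr_ge0|exact: ker].
have g0 : 0 < quadf (gram X) u by rewrite lt_def u0 (proj2 pG).
have d0 : (0 < d)%N.
  rewrite lt0n; apply/eqP => d0; move/eqP: u0; apply; rewrite quadfE bilE.
  by rewrite big1// => i _; have := ltn_ord i; rewrite {2}d0 ltn0.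
apply: (Nhat_bracket (regime_params k1 e01 d0 cond dl01)) g0.
move=> l v [->|->] hv; [exact: HE1|exact: HE2].
Qed.

End sampling.

(** * The accuracy of the estimator *)

Theorem proposition1p2 (R : realType) :
  (forall (d n : nat) (kappa eps : R) (e : 'I_d -> 'cV[R]_d),
    let lambda := lambda_of d n kappa eps in
    let mu := mu_of d n kappa eps in
    let delta := delta_of d n kappa eps in
    1 < kappa -> 0 < eps -> sample_size_cond d n kappa eps ->
    0 < delta < 1 / 2 ->
    orthonormal_basis e ->
    exists Ghat : ('I_n -> 'cV[R]_d) -> 'M[R]_d,
      (forall x : 'I_n -> 'cV[R]_d,
        (exists H, is_Ghat lambda delta e x H) ->
        is_Ghat lambda delta e x (Ghat x)) /\
      (forall (disp0 disp : measure_display)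
          (T0 : measurableType disp0) (P0 : probability T0 R)
          (X : {RV P0 >-> borel_cV R d})
          (T : measurableType disp) (P : probability T R)
          (Xs : 'I_n -> {RV P >-> borel_cV R d}),
        gram_defined X ->
        (kurtosis_sup X <= kappa%:E)%E ->
        mutually_independent Xs ->
        (forall i, same_law (Xs i) X) ->
        exists E : set T,
          [/\ measurable E,
              ((1 - 2 * eps)%R%:E <= P E)%E &
              forall w, E w ->
                let G_w := Ghat (fun i => Xs i w) in
                is_Ghat lambda delta e (fun i => Xs i w) G_w /\
                forall theta : 'cV[R]_d,
                  (`| ediv (quadf G_w theta)%:E (quadf (gram X) theta)%:E - 1 |
                    <= (2 * mu / (1 - 4 * mu))%R%:E)%E]))
  /\
  (forall eta : R, 0 < eta < 1 / 2 ->
    exists c : R, forall (d n : nat) (kappa eps : R),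
      let mu := mu_of d n kappa eps in
      1 < kappa -> 0 < eps <= 1 -> sample_size_cond d n kappa eps ->
      delta_of d n kappa eps <= eta ->
      2 * mu / (1 - 4 * mu)
        <= c * Num.sqrt (kappa * (d%:R + ln eps^-1) / n%:R)).
Proof.
split; last exact: accuracy_rate.
move=> d n kappa eps e lambda mu delta k1 e0 cond dl01 oe.
pose Ghat (x : 'I_n -> 'cV[R]_d) : 'M[R]_d :=
  if pselect (exists H, is_Ghat lambda delta e x H) is left h then projT1 (cid h) else 0.
have GhatP x : (exists H, is_Ghat lambda delta e x H) ->
    is_Ghat lambda delta e x (Ghat x).
  by move=> h; rewrite /Ghat; case: pselect => // h'; case: (cid h').
exists Ghat; split => // disp0 disp T0 P0 X T P Xs gX kX ind law.
(* For [eps >= 1 / 2] the empty event is enough. *)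
have [e1|e1] := leP (1 / 2) eps.
  exists set0; split => //.
  by rewrite measure0 lee_fin; lra.
have e01 : 0 < eps < 1 by apply/andP; split; lra.
have [E [mE PE HE]] := uniform_bracket k1 e01 cond dl01 gX kX ind law.
exists E; split => // w Ew /=.
have [bracket ker] := HE w Ew.
have l0 : 0 <= lambda by exact: sqrtr_ge0.
have /andP[dl0 dl1] := dl01.
have pG := psd_gram gX.
have GH := GhatP _ (is_Ghat_exists e l0 dl0 pG bracket ker).
split => // theta.
have -> : 2 * mu / (1 - 4 * mu) = 2 * delta / (1 - 2 * delta).
  have d12 : 1 - 2 * delta != 0 by rewrite gt_eqF//; lra.
  have dE : delta = mu / (1 - 2 * mu) by [].
  have m2 : 1 - 2 * mu != 0.
    by apply: contraTneq dl0 => m0; rewrite dE m0 invr0 mulr0 ltxx.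
  have e2 : 1 - 2 * delta = (1 - 4 * mu) / (1 - 2 * mu) by rewrite dE; field.
  have m4 : 1 - 4 * mu != 0.
    by apply: contraNneq d12 => m0; rewrite e2 m0 mul0r.
  by rewrite e2 dE; field; rewrite m2.
exact: (is_Ghat_bound l0 dl0 dl1 oe pG bracket ker).
Qed.
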